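(* Fix a base $B>1$ and $\delta\in(0,1)$. Let $X_1,X_2,\dots$ be independent, identically distributed real random variables whose density $f$ has a second order Taylor series at each point, with first and second derivatives uniformly bounded. For each $N$ let $X_{1:N}\le\cdots\le X_{N:N}$ be $X_1,\dots,X_N$ in increasing order. Let $J\subset\mathbb{R}$ be an interval on which $f$ is bounded away from zero, and for each $N$ let $i_N$ be an index with $1\le i_N$ and $i_N+\lfloor N^\delta\rfloor\le N$ such that, with probability tending to $1$ as $N\to\infty$, the order statistics $X_{i_N:N},X_{i_N+1:N},\dots,X_{i_N+\lfloor N^\delta\rfloor:N}$ all lie in $J$. Then, as $N\to\infty$, the distribution of the digits (base $B$) of the $\lfloor N^\delta\rfloor$ consecutive differences $X_{i+1:N}-X_{i:N}$, $i_N\le i<i_N+\lfloor N^\delta\rfloor$, converges to shifted exponential behavior. That is, there are constants $C_N>0$ such that, if $\zeta$ has the standard exponential distribution, for every $[\alpha,\beta]\subset[0,1]$, $$\frac{1}{\lfloor N^\delta\rfloor}\,\#\Big\{i_N\le i<i_N+\lfloor N^\delta\rfloor:\ \log_B\big(C_N(X_{i+1:N}-X_{i:N})\big)\bmod 1\in[\alpha,\beta]\Big\}\ \longrightarrow\ \mathrm{Prob}\big(\log_B\zeta\bmod 1\in[\alpha,\beta]\big)$$ in probability as $N\to\infty$.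
   Context: Here $x \bmod 1\in[0,1)$ denotes the fractional part of the real number $x$. The standard exponential distribution is the law on $[0,\infty)$ with density $e^{-t}$. The distribution of the digits base $B$ of a positive quantity $x$ means the distribution of its mantissa $M_B(x)\in[1,B)$, where $x=M_B(x)B^k$ with $k\in\mathbb{Z}$; equivalently, the distribution of $\log_B x\bmod 1$. A collection of positive numbers exhibits exponential behavior (base $B$) if its distribution of digits base $B$ equals that of $\zeta$; it exhibits shifted exponential behavior if there is $C>0$ such that the collection multiplied by $C$ exhibits exponential behavior. The shift is allowed to depend on $N$ and on which block of consecutive differences is studied. *)

(* Defs.v *)
From HB Require Import structures.
From mathcomp Require Import all_boot all_order all_algebra.
From mathcomp Require Import finmap.
From mathcomp Require Import all_classical all_reals all_analysis.

Set Implicit Arguments.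
Unset Strict Implicit.
Unset Printing Implicit Defensive.

Import Order.TTheory GRing.Theory Num.Theory.
Import numFieldNormedType.Exports.

Local Open Scope classical_set_scope.
Local Open Scope ring_scope.

(* A sequence X_1, X_2, ... of random variables is a function X on nat in which
   X j stands for X_{j+1}. *)

Definition independent_RVs (d : measure_display) (T : measurableType d)
    (R : realType) (P : probability T R) (X : nat -> {RV P >-> R}) : Prop :=
  forall (S : {fset nat}) (A : nat -> set R),
    (forall j, measurable (A j)) ->
    P (\bigcap_(j in [set` S]) (X j @^-1` A j)) =
      (\prod_(j <- S) P (X j @^-1` A j))%E.

Definition identically_distributed (d : measure_display)
    (T : measurableType d) (R : realType) (P : probability T R)
    (X : nat -> {RV P >-> R}) : Prop :=
  forall (j k : nat) (A : set R), measurable A ->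
    distribution P (X j) A = distribution P (X k) A.

Definition has_density (d : measure_display) (T : measurableType d)
    (R : realType) (P : probability T R) (X : {RV P >-> R}) (f : R -> R) :
    Prop :=
  [/\ measurable_fun [set: R] f, (forall x, 0 <= f x) &
      forall A : set R, measurable A ->
        distribution P X A = (\int[lebesgue_measure]_(x in A) (f x)%:E)%E].

(* Twice differentiable on the whole line (so that f has a second order Taylor
   expansion at each point), with f' and f'' uniformly bounded; f'' need not be
   continuous. *)
Definition twice_derivable_bounded (R : realType) (f : R -> R) : Prop :=
  [/\ (forall x, derivable f x 1), (forall x, derivable (derive1 f) x 1) &
      exists M : R, forall x,
        `|derive1 f x| <= M /\ `|derive1 (derive1 f) x| <= M].

Definition bounded_away_from_zero (R : realType) (f : R -> R) (J : set R) :
    Prop :=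
  exists2 c : R, 0 < c & forall x, J x -> c <= f x.

(* X_{k:N}, with 1 <= k <= N: the k-th smallest of X_1, ..., X_N. *)
Definition order_stat (T : Type) (R : realType) (X : nat -> T -> R)
    (N k : nat) (w : T) : R :=
  nth 0 (sort <=%R (mkseq (fun j => X j w) N)) k.-1.

Definition fracpart (R : realType) (x : R) : R := x - (Num.floor x)%:~R.

(* log_B x mod 1, meaningful for x > 0; the library sets ln x = 0 for
   x <= 0. *)
Definition log_mod1 (R : realType) (B x : R) : R := fracpart (ln x / ln B).

(* floor (N ^ delta) as a natural number *)
Definition block_size (R : realType) (delta : R) (N : nat) : nat :=
  Num.truncn (N%:R `^ delta).

Definition digit_freq (T : Type) (R : realType) (X : nat -> T -> R)
    (B c a b : R) (N i m : nat) (w : T) : R :=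
  (count (fun k => log_mod1 B
             (c * (order_stat X N k.+1 w - order_stat X N k w)) \in `[a, b])
         (index_iota i (i + m)))%:R / m%:R.

Definition cvg_in_probability (d : measure_display) (T : measurableType d)
    (R : realType) (P : probability T R) (Y : nat -> T -> R) (l : R) : Prop :=
  forall eps : R, 0 < eps ->
    P [set w | eps <= `|Y N w - l|] @[N --> \oo] --> 0%E.

(* Prob (log_B zeta mod 1 \in [a, b]) for zeta standard exponential *)
Definition exponential_digit_prob (R : realType) (B a b : R) : R :=
  fine (exponential_prob 1 [set t : R | log_mod1 B t \in `[a, b]]).

(* Main.v *)
Require Import Defs.
From HB Require Import structures.
From mathcomp Require Import all_boot all_order all_algebra.
From mathcomp Require Import finmap.
From mathcomp Require Import all_classical all_reals all_analysis.
From mathcomp Require Import measurable_realfun zify ring lra.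

(* By the probability integral transform U = F(X) the problem is one about
   uniform spacings, up to the factor f, which is nearly constant on the block:
   the order statistics X_{i_N:N}, ..., X_{i_N+m:N} stay near a deterministic
   point q_N of J, because F(X_{k:N}) is close to k/N.  Hence the shift
   C_N = N f(q_N).  The uniform variables are discretised into L = N^3 cells of
   equal probability, so that only the number of tuples in [0, L)^N with given
   properties matters.  Moving all the points above the k-th smallest one down
   by a maps the tuples whose k-th gap exceeds a injectively into [0, L - a)^N,
   and almost onto it; doing this at two places bounds the pairs of large gaps
   by (L - 2a)^N.  With a = sL/N this gives the first two moments e^{-s} and
   e^{-2s}, and Chebyshev's inequality shows that the proportion of normalised
   spacings exceeding s tends to e^{-s} in probability.  Finally the digit set
   is a union of intervals [B^{n+a}, B^{n+b}] over n in Z; finitely many of them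
   carry all but a small mass, both for the spacings and for the exponential
   law. *)

Set Implicit Arguments.
Unset Strict Implicit.
Unset Printing Implicit Defensive.

Import Order.TTheory GRing.Theory Num.Theory.
Import numFieldNormedType.Exports.

(** * Counting tuples with large gaps *)

(** The spacings in a block are dependent, so their law of large numbers has to come from two
    moments, and discretising turns both into injection counts. Expanding the variance around
    [p = e^(-s)] calls only for lower bounds on single gap events and upper bounds on pairs. These
    are the directions in which the injections work: closing gaps is injective without restriction,
    while reopening one needs distinct values, hence a falling factorial. Ties are harmless once
    [N^2 / L] tends to 0, and a gap spans [s * L / N] cells; [L = N^3] makes the first [1 / N] and
    the second [s * N^2], so that rounding by one cell is negligible. The shift may depend on [N]
    but not on the outcome, so [q N] must be fixed beforehand; since [i_N / N] need not be a value
    of [F] on [J], it is a near minimiser over [J] of the distance from [F] to [i_N / N]. Empirical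
    counts may charge endpoints of intervals, so upper bounds are proved for weak inequalities and
    lower bounds for strict ones. *)

Lemma sort_map_homo (T T' : eqType) (r : rel T) (r' : rel T') (g : T -> T')
    (s : seq T) : total r -> total r' -> transitive r' -> antisymmetric r' ->
  {in s &, {homo g : x y / r x y >-> r' x y}} ->
  sort r' (map g s) = map g (sort r s).
Proof.
move=> tr tr' tr'' ar' gh; apply: (sorted_eq tr'' ar').
- exact: sort_sorted.
- have : sorted r (sort r s) by exact: sort_sorted.
  apply: (homo_sorted_in (P := mem s)).
    by move=> x y xs ys; apply: gh.
  by apply/allP => x; rewrite mem_sort.
- by rewrite perm_sort perm_sym perm_map // perm_sort.
Qed.

Definition vals (N L : nat) (v : {ffun 'I_N -> 'I_L}) : seq nat :=
  [seq val (v j) | j <- enum 'I_N].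

(* The (k+1)-st smallest value: k counts from 0, unlike in [order_stat]. *)
Definition vstat (N L : nat) (v : {ffun 'I_N -> 'I_L}) (k : nat) : nat :=
  nth 0 (sort leq (vals v)) k.

Lemma size_vals N L (v : {ffun 'I_N -> 'I_L}) : size (vals v) = N.
Proof. by rewrite size_map -cardE card_ord. Qed.

Lemma mem_vals N L (v : {ffun 'I_N -> 'I_L}) j : val (v j) \in vals v.
Proof. by apply: map_f; rewrite mem_enum. Qed.

Lemma vstat_mem N L (v : {ffun 'I_N -> 'I_L}) k : k < N ->
  exists j, vstat v k = v j.
Proof.
move=> kN; have : vstat v k \in vals v.
  by rewrite -(mem_sort leq) mem_nth // size_sort size_vals.
by case/mapP => j _ ->; exists j.
Qed.

Lemma vstat_lt N L (v : {ffun 'I_N -> 'I_L}) k : k < N -> vstat v k < L.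
Proof. by move=> /(vstat_mem v)[j ->]. Qed.

Lemma vstat_homo N L (v : {ffun 'I_N -> 'I_L}) k l : k <= l -> l < N ->
  vstat v k <= vstat v l.
Proof.
move=> kl lN; apply: (sorted_leq_nth leq_trans) => //.
- exact: sort_sorted leq_total _.
- by rewrite inE size_sort size_vals; lia.
- by rewrite inE size_sort size_vals.
Qed.

(** The emptiness of the range between consecutive order statistics reduces the shift arguments
    below to linear arithmetic on each coordinate. *)
Lemma vstat_split N L (v : {ffun 'I_N -> 'I_L}) k x : x \in vals v ->
  k.+1 < N -> x <= vstat v k \/ vstat v k.+1 <= x.
Proof.
rewrite -(mem_sort leq) => /(nthP 0)[p]; rewrite size_sort size_vals => pN <- kN.
have [pk|kp] := leqP p k; [left|right]; apply: vstat_homo => //; lia.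
Qed.

(** Monotonicity is asked only on the values taken: lowering everything above a threshold by [a] is
    monotone there because the gap is empty, but not on all of [nat]. *)
Lemma vals_comp N L L' (v : {ffun 'I_N -> 'I_L}) (u : {ffun 'I_N -> 'I_L'}) g :
  (forall j, val (u j) = g (val (v j))) ->
  {in vals v &, {homo g : x y / x <= y}} ->
  forall k, k < N -> vstat u k = g (vstat v k).
Proof.
move=> ug gh k kN; rewrite /vstat.
have -> : vals u = map g (vals v).
  by rewrite /vals -map_comp; apply: eq_map => j /=; rewrite ug.
rewrite (sort_map_homo leq_total leq_total leq_trans anti_leq gh).
by rewrite (nth_map 0) // size_sort size_vals.
Qed.

(** An injection presented by its decoding: [r u v] says that [u] encodes [v]. A code determines
    what it encodes, so picking any code for each [v] is injective. *)
Lemma card_le_rel (A D : finType) (C : {set A}) (E : {set D})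
    (r : D -> A -> bool) :
  (forall v, v \in C -> exists2 u, u \in E & r u v) ->
  (forall u v v', r u v -> r u v' -> v = v') -> #|C| <= #|E|.
Proof.
move=> h rinj; pose g v := [pick u in E | r u v].
have gP v : v \in C -> exists u, [/\ g v = Some u, u \in E & r u v].
  move=> /h[u uE ruv]; rewrite /g; case: pickP => [w /andP[wE rw]|/(_ u)].
    by exists w.
  by rewrite uE ruv.
have ginj : {in C &, injective g}.
  move=> v w /gP[u [gu _ ru]] /gP[u' [gu' _ ru']].
  by rewrite gu gu' => -[uu']; apply: (rinj u); rewrite // uu'.
rewrite -(card_in_imset ginj).
have <- : #|Some @: E| = #|E| by apply: card_imset => x y [].
apply: subset_leq_card; apply/fintype.subsetP => o /imsetP[v /gP[u [gu uE _]] ->].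
by rewrite gu imset_f.
Qed.

Definition gap_set (N L a k : nat) : {set {ffun 'I_N -> 'I_L}} :=
  [set v | a + vstat v k < vstat v k.+1].

(* The k-th and l-th order statistics of the shifted tuple recover the two
   thresholds above which values were lowered, so the shift is injective. *)
Lemma card_gap_set2 N L a k l : k < l -> l.+1 < N ->
  #|gap_set N L a k :&: gap_set N L a l| <= (L - a - a) ^ N.
Proof.
move=> kl lN; pose L' := L - a - a.
have -> : (L - a - a) ^ N = #|{: {ffun 'I_N -> 'I_L'}}|.
  by rewrite card_ffun !card_ord.
pose r (u : {ffun 'I_N -> 'I_L'}) (v : {ffun 'I_N -> 'I_L}) :=
  [forall j, val (v j) == val (u j) + (if vstat u k < val (u j) then a else 0)
                                + (if vstat u l < val (u j) then a else 0)].
rewrite -[leqRHS]cardsT; apply: (card_le_rel (r := r)); last first.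
  move=> u v v' /forallP h /forallP h'; apply/ffunP => j; apply/val_inj.
  by rewrite (eqP (h j)) (eqP (h' j)).
move=> v; rewrite !inE => /andP[vk vl].
(* Here [k < l] matters: the lower end of the second gap sits above the first gap, so it is itself
   lowered by [a]. *)
have kl' : vstat v k.+1 <= vstat v l by apply: vstat_homo; lia.
have vL := vstat_lt v lN.
pose psi x := x - (if vstat v k < x then a else 0)
                - (if vstat v l < x then a else 0).
have kN : k.+1 < N by lia.
(* The values left in place fit too: since [vstat v l.+1 < L] and each gap exceeds [a], [vstat v l]
   is below [L - a] and [vstat v k] below [L - 2a]. *)
have psiL j : psi (v j) < L'.
  have := vstat_split (mem_vals v j) kN.
  have := vstat_split (mem_vals v j) lN.
  have := ltn_ord (v j).
  by rewrite /psi /L' => *; do 2 case: ifP => *; lia.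
pose u : {ffun 'I_N -> 'I_L'} := [ffun j => Ordinal (psiL j)].
have uE j : val (u j) = psi (val (v j)) by rewrite ffunE.
have psih : {in vals v &, {homo psi : x y / x <= y}}.
  move=> x y xv yv xy.
  have := vstat_split xv kN; have := vstat_split yv kN.
  have := vstat_split xv lN; have := vstat_split yv lN.
  by rewrite /psi => *; do 4 case: ifP => *; lia.
have uk : vstat u k = vstat v k.
  by rewrite (vals_comp uE psih) /psi ?ltnn; [case: ifP => ?; lia|lia].
have ul : vstat u l = vstat v l - a.
  rewrite (vals_comp uE psih) /psi ?ltnn; [|lia].
  by case: ifP => ?; lia.
exists u; rewrite ?inE //; apply/forallP => j; apply/eqP; rewrite uk ul uE /psi.
have := vstat_split (mem_vals v j) kN.
have := vstat_split (mem_vals v j) lN.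
by move: (val (v j)) => x *; do 4 case: ifP => *; lia.
Qed.

(** Reopening a gap: everything above the k-th value is raised by [a]. Distinctness makes the k-th
    value differ from the next one, so that the raised gap exceeds [a]; decoding uses the k-th
    value, which has not moved. *)
Lemma card_gap_set N L a k : k.+1 < N ->
  (L - a) ^_ N <= #|gap_set N L a k|.
Proof.
move=> kN; pose L' := L - a.
have -> : (L - a) ^_ N = #|[set u : {ffun 'I_N -> 'I_L'} | injectiveb u]|.
  by rewrite card_inj_ffuns !card_ord.
pose r (v : {ffun 'I_N -> 'I_L}) (u : {ffun 'I_N -> 'I_L'}) :=
  [forall j, val (u j) == val (v j) - (if vstat v k < val (v j) then a else 0)].
apply: (card_le_rel (r := r)); last first.
  move=> v u u' /forallP h /forallP h'; apply/ffunP => j; apply/val_inj.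
  by rewrite (eqP (h j)) (eqP (h' j)).
move=> u; rewrite !inE => /injectiveP uinj.
have uk1 : vstat u k < vstat u k.+1.
  have us : uniq (sort leq (vals u)).
    rewrite sort_uniq map_inj_uniq ?enum_uniq // => x y /val_inj; exact: uinj.
  have := vstat_homo u (leqnSn k) kN; rewrite leq_eqVlt => /predU1P[|//].
  move/eqP; rewrite nth_uniq ?size_sort ?size_vals //; lia.
pose psi x := x + (if vstat u k < x then a else 0).
have psiL j : psi (u j) < L.
  have uj : u j < L - a := ltn_ord (u j).
  by rewrite /psi; case: ifP => *; lia.
pose v : {ffun 'I_N -> 'I_L} := [ffun j => Ordinal (psiL j)].
have vE j : val (v j) = psi (val (u j)) by rewrite ffunE.
have psih : {in vals u &, {homo psi : x y / x <= y}}.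
  by move=> x y _ _ xy; rewrite /psi; do 2 case: ifP => *; lia.
have vk : vstat v k = vstat u k.
  by rewrite (vals_comp vE psih) /psi ?ltnn; lia.
have vk1 : vstat v k.+1 = vstat u k.+1 + a.
  by rewrite (vals_comp vE psih) /psi ?uk1; lia.
exists v; first by rewrite inE vk vk1; lia.
apply/forallP => j; apply/eqP; rewrite vk vE /psi.
by move: (val (u j)) => x; do 2 case: ifP => *; lia.
Qed.

Lemma ffact_ge n m : m <= n -> (n - m) ^ m <= n ^_ m.
Proof.
elim: m n => [|m IH] [|n] //= mn; rewrite ffactnS expnS leq_mul ?leq_subr //.
by rewrite subSS; exact: (leq_trans _ (IH _ mn)).
Qed.

(** Trades an order statistic for a count. A count is a sum over coordinates, so its variance can be
    computed (for [vstat]) and it is measurable (for [order_stat]). *)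
Lemma nth_sort_count (disp : Order.disp_t) (T : orderType disp) (x0 t : T)
    (s : seq T) (k : nat) : (k < size s)%N ->
  (t <= nth x0 (sort <=%O s) k)%O = (count (fun x => x < t)%O s <= k)%N.
Proof.
move=> ks; rewrite -(permP (permEl (perm_sort <=%O s))).
set r := sort _ _; have sr : sorted <=%O r by exact: sort_sorted (@le_total _ _) _.
have szr : size r = size s by rewrite size_sort.
have homo := sorted_leq_nth le_trans lexx x0 sr.
apply/idP/idP => h.
  rewrite -(cat_take_drop k r) count_cat.
  have -> : count (< t)%O (drop k r) = 0%N.
    apply/eqP; rewrite -leqn0 leqNgt -has_count; apply/hasPn => x.
    move=> /(nthP x0)[p]; rewrite size_drop nth_drop szr => pk <-; rewrite -leNgt.
    apply: (le_trans h); apply: homo; rewrite ?inE ?szr ?leq_addr //.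
    by rewrite -ltn_subRL.
  by rewrite addn0 (leq_trans (count_size _ _)) // size_take szr ks.
rewrite leNgt; apply/negP => h'; move: h; apply/negP; rewrite -ltnNge.
rewrite -(cat_take_drop k.+1 r) count_cat.
have szt : size (take k.+1 r) = k.+1.
  by rewrite size_takel // szr.
suff /eqP -> : count (< t)%O (take k.+1 r) == k.+1 by rewrite leq_addr.
rewrite -[X in _ == X]szt -all_count; apply/(all_nthP x0) => p; rewrite szt => pk.
rewrite nth_take //; apply: le_lt_trans h'; apply: homo => //.
  by rewrite inE szr (leq_ltn_trans _ ks).
by rewrite inE szr.
Qed.

Lemma vstat_count N L (v : {ffun 'I_N -> 'I_L}) k t : k < N ->
  (t <= vstat v k) = (#|[set j | v j < t]%SET| <= k).
Proof.
move=> kN; have -> : #|[set j | v j < t]%SET| = count (fun x => x < t) (vals v).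
  rewrite count_map cardE -size_filter.
  by congr size; rewrite enumT; apply: eq_filter => j; rewrite !inE.
by apply: (@nth_sort_count _ nat 0 t (vals v) k); rewrite size_vals.
Qed.

Local Open Scope ring_scope.

(** * Chebyshev's inequality over the finite set of tuples *)

Lemma markov_card (R : realFieldType) (T : finType) (C : {set T}) (g : T -> R) (e : R) :
  (forall v, 0 <= g v) -> (forall v, v \in C -> e <= g v) ->
  #|C|%:R * e <= \sum_v g v.
Proof.
move=> g0 gC; rewrite (bigID (mem C)) /= -[leLHS]addr0 lerD ?sumr_ge0 //.
by rewrite mulr_natl -sumr_const ler_sum.
Qed.

Lemma sum_indic (R : pzSemiRingType) (T : finType) (C : {pred T}) :
  \sum_v (v \in C)%:R = #|C|%:R :> R.
Proof.
rewrite -sum1_card [in RHS]big_mkcond natr_sum.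
by apply: eq_bigr => v _; case: (v \in C).
Qed.

(** With [x], [y], [z] the sizes of two gap sets and of their intersection, the left side is the sum
    over tuples of the product of the two centred indicators. The 3 is [1 + 2p] bounded by means of
    [p <= 1]. *)
Lemma offdiag_le (R : realFieldType) (p eta W x y z : R) : 0 <= p -> p <= 1 ->
  0 <= W -> 0 <= eta -> (p - eta) * W <= x -> (p - eta) * W <= y ->
  z <= (p ^+ 2 + eta) * W -> z - p * x - p * y + p ^+ 2 * W <= 3 * eta * W.
Proof.
move=> p0 p1 W0 eta0 hx hy hz.
have px : p * ((p - eta) * W) <= p * x by rewrite ler_wpM2l.
have py : p * ((p - eta) * W) <= p * y by rewrite ler_wpM2l.
have eW : 0 <= eta * W by rewrite mulr_ge0.
have peW : p * (eta * W) <= eta * W by rewrite ler_piMl.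
lra.
Qed.

Lemma diag_le (R : realFieldType) (p W x : R) : 0 <= p -> p <= 1 ->
  0 <= x -> x <= W -> x - p * x - p * x + p ^+ 2 * W <= W.
Proof.
move=> p0 p1 x0 xW.
have p0x : 0 <= p * x by rewrite mulr_ge0.
have p2W : p * (p * W) <= p * W by rewrite ler_wpM2l // ler_piMl // (le_trans x0).
have : 0 <= (1 - p) * (W - x) by rewrite mulr_ge0 // subr_ge0.
lra.
Qed.

(** In the variance, a double sum over [k, l < m], the [m] diagonal terms of size at most [L ^ N]
    yield [1 / m] and the remaining ones at most [3 * eta]. *)
Lemma gap_freq_card (R : realFieldType) (N L a j m : nat) (p eta e : R) :
  (j + m < N)%N -> (0 < m)%N -> 0 <= p <= 1 -> 0 <= eta -> 0 <= e ->
  (forall k, (k.+1 < N)%N -> (p - eta) * (L ^ N)%:R <= #|gap_set N L a k|%:R) ->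
  (forall k l, (k < l)%N -> (l.+1 < N)%N ->
     #|gap_set N L a k :&: gap_set N L a l|%:R <= (p ^+ 2 + eta) * (L ^ N)%:R) ->
  #|[set v : {ffun 'I_N -> 'I_L} | e <=
      `|(\sum_(k < m) (v \in gap_set N L a (j + k)))%:R / m%:R - p|]|%:R * e ^+ 2
    <= (m%:R^-1 + 3 * eta) * (L ^ N)%:R.
Proof.
move=> jmN m0 /andP[p0 p1] eta0 e0 h1 h2.
set W : R := (L ^ N)%:R; have W0 : 0 <= W by [].
have cW (C : {set {ffun 'I_N -> 'I_L}}) : #|C|%:R <= W.
  by rewrite ler_nat -[in leqRHS](card_ord L) -[in leqRHS](card_ord N) -card_ffun max_card.
set G := fun k => gap_set N L a (j + k).
have mR : 0 < m%:R :> R by rewrite ltr0n.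
pose g (v : {ffun 'I_N -> 'I_L}) : R :=
  ((\sum_(k < m) (v \in G k))%:R / m%:R - p) ^+ 2.
apply: (le_trans (markov_card (g := g) _ _)).
- by move=> v; exact: sqr_ge0.
- move=> v; rewrite inE => ev; rewrite /g -[leRHS]real_normK ?num_real //.
  by rewrite lerXn2r ?nnegrE.
have gE v : g v = m%:R^-2 * \sum_(k < m) \sum_(l < m)
   ((v \in G k :&: G l)%:R - p * (v \in G k)%:R - p * (v \in G l)%:R + p ^+ 2).
  rewrite /g; have -> : (\sum_(k < m) (v \in G k))%:R / m%:R - p
      = m%:R^-1 * \sum_(k < m) ((v \in G k)%:R - p).
    rewrite sumrB sumr_const card_ord natr_sum -[p *+ m]mulr_natl; field.
    by rewrite lt0r_neq0.
  rewrite exprMn exprVn; congr (_ * _).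
  rewrite expr2 big_distrl /=; apply: eq_bigr => k _; rewrite big_distrr /=.
  apply: eq_bigr => l _; rewrite finset.in_setI.
  by case: (v \in G k); case: (v \in G l) => /=; ring.
under eq_bigr do rewrite gE.
rewrite -big_distrr /= exchange_big /=.
under eq_bigr do rewrite exchange_big /=.
have term k l : (k < m)%N -> (l < m)%N -> \sum_(v : {ffun 'I_N -> 'I_L})
    ((v \in G k :&: G l)%:R - p * (v \in G k)%:R - p * (v \in G l)%:R + p ^+ 2)
    <= W * (k == l)%:R + 3 * eta * W.
  move=> km lm.
  have -> : \sum_(v : {ffun 'I_N -> 'I_L})
    ((v \in G k :&: G l)%:R - p * (v \in G k)%:R - p * (v \in G l)%:R + p ^+ 2)
    = #|G k :&: G l|%:R - p * #|G k|%:R - p * #|G l|%:R + p ^+ 2 * W.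
    rewrite big_split !sumrB /= -!big_distrr /= !sum_indic sumr_const.
    rewrite -[p *+ _]mulr_natr expr2 -mulrA; congr (_ + p * (p * _%:R)).
    by rewrite card_ffun !card_ord.
  have hk : (p - eta) * W <= #|G k|%:R.
    by apply: h1; rewrite (leq_ltn_trans _ jmN) // -addnS leq_add2l.
  have hl : (p - eta) * W <= #|G l|%:R.
    by apply: h1; rewrite (leq_ltn_trans _ jmN) // -addnS leq_add2l.
  have [kl|lk|->] := ltngtP k l.
  - have lN : ((j + l).+1 < N)%N by rewrite (leq_ltn_trans _ jmN) // -addnS leq_add2l.
    have jkl : (j + k < j + l)%N by rewrite ltn_add2l.
    rewrite mulr0 add0r.
    exact: (offdiag_le p0 p1 (ler0n _ _) eta0 hk hl (h2 _ _ jkl lN)).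
  - have kN : ((j + k).+1 < N)%N by rewrite (leq_ltn_trans _ jmN) // -addnS leq_add2l.
    have jlk : (j + l < j + k)%N by rewrite ltn_add2l.
    rewrite mulr0 add0r; apply: (offdiag_le p0 p1 (ler0n _ _) eta0 hk hl).
    rewrite finset.setIC; exact: (h2 _ _ jlk kN).
  - rewrite finset.setIid mulr1; apply: (@le_trans _ _ W).
      exact: (diag_le p0 p1 (ler0n _ _) (cW _)).
    by rewrite lerDl !mulr_ge0.
have tot : \sum_(k < m) \sum_(l < m) (\sum_(v : {ffun 'I_N -> 'I_L})
    ((v \in G k :&: G l)%:R - p * (v \in G k)%:R - p * (v \in G l)%:R + p ^+ 2))
    <= W * m%:R + 3 * eta * W * m%:R ^+ 2.
  apply: (@le_trans _ _ (\sum_(k < m) \sum_(l < m) (W * (k == l)%:R + 3 * eta * W))).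
    by apply: ler_sum => k _; apply: ler_sum => l _; exact: term.
  rewrite le_eqVlt; apply/orP; left; apply/eqP.
  transitivity (\sum_(k < m) (W + 3 * eta * W * m%:R)).
    apply: eq_bigr => k _; rewrite big_split /= -big_distrr /= (bigD1 k) //= eqxx.
    rewrite big1 ?addr0; last by move=> l; rewrite eq_sym => /negbTE ->.
    by rewrite mulr1 sumr_const card_ord mulr_natr.
  rewrite sumr_const card_ord -mulr_natr; ring.
apply: (le_trans (ler_wpM2l _ tot)); first by rewrite invr_ge0 sqr_ge0.
rewrite le_eqVlt; apply/orP; left; apply/eqP; field; exact: lt0r_neq0.
Qed.

(** Orthogonality of centred functions of distinct coordinates: the sum factorises over the
    coordinates, and the factor at [j] is [\sum_x z x]. *)
Lemma sum_ffun_prod2 (R : realFieldType) (N L : nat) (z : 'I_L -> R) (j l : 'I_N) :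
  j != l -> \sum_x z x = 0 ->
  \sum_(v : {ffun 'I_N -> 'I_L}) z (v j) * z (v l) = 0.
Proof.
move=> jl z0; pose F (i : 'I_N) x := if (i == j) || (i == l) then z x else 1.
transitivity (\sum_(v : {ffun 'I_N -> 'I_L}) \prod_i F i (v i)).
  apply: eq_bigr => v _; rewrite (bigD1 j) //= (bigD1 l) /=; last by rewrite eq_sym.
  rewrite /F !eqxx orbT /= big1 ?mulr1 // => i /andP[/negbTE -> /negbTE ->] //.
rewrite -bigA_distr_bigA (bigD1 j) //= /F eqxx /=.
by rewrite [X in X * _](_ : _ = 0) ?mul0r.
Qed.

(** The variance of a binomial count: the cross terms vanish, and each squared centred indicator is
    bounded crudely by 1. *)
Lemma count_variance (R : realFieldType) (N L t : nat) : (t <= L)%N -> (0 < L)%N ->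
  \sum_(v : {ffun 'I_N -> 'I_L})
    (#|[set j | (v j < t)%N]|%:R - N%:R * (t%:R / L%:R)) ^+ 2
    <= N%:R * (L ^ N)%:R :> R.
Proof.
move=> tL L0; pose z (x : 'I_L) : R := (x < t)%N%:R - t%:R / L%:R.
have LR : 0 < L%:R :> R by rewrite ltr0n.
have z0 : \sum_x z x = 0.
  rewrite sumrB sumr_const card_ord (sum_indic _ [pred x : 'I_L | (x < t)%N]).
  have -> : #|[pred x : 'I_L | (x < t)%N]| = t.
    have winj : injective (widen_ord tL) by move=> x y /(congr1 val) /= /val_inj.
    rewrite -[RHS]card_ord -(card_imset predT winj).
    apply: eq_card => x; rewrite !inE; apply/idP/imsetP => [xt|[y _ ->]] //=.
    by exists (Ordinal xt) => //; apply/val_inj.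
  by rewrite -[_ / _ *+ _]mulr_natr mulfVK ?subrr ?lt0r_neq0.
under eq_bigr => v _.
  have -> : #|[set j | (v j < t)%N]|%:R - N%:R * (t%:R / L%:R) = \sum_j z (v j) :> R.
    rewrite sumrB sumr_const card_ord mulr_natl -sum_indic.
    by congr (_ - _); apply: eq_bigr => j _; rewrite inE.
  rewrite expr2 big_distrl /=.
  under eq_bigr => j _ do rewrite big_distrr /=.
  over.
rewrite exchange_big /=; under eq_bigr do rewrite exchange_big /=.
apply: (@le_trans _ _ (\sum_(j < N) (L ^ N)%:R)); last first.
  by rewrite sumr_const card_ord mulr_natl.
apply: ler_sum => j _; rewrite (bigD1 j) //= [X in _ + X]big1 ?addr0; last first.
  by move=> l lj; apply: sum_ffun_prod2; rewrite // eq_sym.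
have -> : (L ^ N)%:R = \sum_(v : {ffun 'I_N -> 'I_L}) 1 :> R.
  by rewrite sumr_const card_ffun !card_ord.
apply: ler_sum => v _; rewrite -expr2 /z.
have q0 : 0 <= t%:R / L%:R :> R by rewrite divr_ge0.
have q1 : t%:R / L%:R <= 1 :> R by rewrite ler_pdivrMr // mul1r ler_nat.
by case: (_ < _)%N => /=; nra.
Qed.

(** A k-th value far from [k / N] forces the count below a threshold [t] away from its mean. With
    [t / L] at distance between [eta / 2] and [eta] from [k / N], the count deviates by
    [N * eta / 2], which gives a constant 4 for each side; [2 <= L * eta] pays for rounding [t] to
    an integer. *)
Lemma vstat_dev_card (R : archiRealFieldType) (N L k : nat) (eta : R) : (k < N)%N ->
  0 < eta -> 2 <= L%:R * eta ->
  #|[set v : {ffun 'I_N -> 'I_L} | eta <= `|(vstat v k)%:R / L%:R - k%:R / N%:R|]|%:R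
    <= 8 / (N%:R * eta ^+ 2) * (L ^ N)%:R.
Proof.
move=> kN eta0 Leta.
have L0 : (0 < L)%N by case: (L) Leta => //; rewrite mul0r; lra.
have LR : 0 < L%:R :> R by rewrite ltr0n.
have NR : 0 < N%:R :> R by rewrite ltr0n; lia.
pose c (t : nat) (v : {ffun 'I_N -> 'I_L}) : R := #|[set j | (v j < t)%N]|%:R.
have mark t (C : {set {ffun 'I_N -> 'I_L}}) : (t <= L)%N ->
    (forall v, v \in C -> N%:R * eta / 2 <= `|c t v - N%:R * (t%:R / L%:R)|) ->
    #|C|%:R <= 4 / (N%:R * eta ^+ 2) * (L ^ N)%:R :> R.
  move=> tL hC.
  have /le_trans/(_ (count_variance R N tL L0)) : #|C|%:R * (N%:R * eta / 2) ^+ 2 <=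
      \sum_v (c t v - N%:R * (t%:R / L%:R)) ^+ 2.
    apply: markov_card => v; first exact: sqr_ge0.
    move=> /hC h; rewrite -[leRHS]real_normK ?num_real // lerXn2r // nnegrE.
    by rewrite !mulr_ge0 ?invr_ge0 ?ler0n ?ltW.
  rewrite -ler_pdivlMr; last by rewrite exprn_gt0 // !mulr_gt0 ?invr_gt0.
  move=> /le_trans; apply; rewrite le_eqVlt; apply/orP; left; apply/eqP.
  by field; rewrite !lt0r_neq0.
set A1 := [set v : {ffun 'I_N -> 'I_L} | (vstat v k)%:R / L%:R <= k%:R / N%:R - eta].
set A2 := [set v : {ffun 'I_N -> 'I_L} | k%:R / N%:R + eta <= (vstat v k)%:R / L%:R].
have hA1 : #|A1|%:R <= 4 / (N%:R * eta ^+ 2) * (L ^ N)%:R :> R.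
  (* An element of [A1] shows that [0 <= x], so that truncation brackets [x]; in the mirror case
     below, an element of [A2] gives [t <= L]. *)
  have [->|[v0]] := set_0Vmem A1.
    by rewrite cards0 !mulr_ge0 ?invr_ge0 ?mulr_ge0 ?ler0n ?ltW // exprn_gt0.
  rewrite inE => hv0; set x := L%:R * (k%:R / N%:R - eta).
  have x0 : 0 <= x.
    by rewrite mulr_ge0 ?ler0n // (le_trans _ hv0) // divr_ge0.
  have /andP[xt1 xt2] := truncn_itv x0.
  set t := (Num.truncn x).+1.
  have tx : t%:R <= L%:R * (k%:R / N%:R - eta / 2).
    by rewrite /t -natr1; move: xt1; rewrite /x; nra.
  have kN1 : k%:R / N%:R <= 1 :> R by rewrite ler_pdivrMr // mul1r ler_nat ltnW.
  have tL : (t <= L)%N.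
    by rewrite -(ler_nat R); apply: (le_trans tx); rewrite ler_piMr ?ler0n //; lra.
  apply: (mark t) => // v; rewrite inE => hv.
  have : (k < #|[set j | (v j < t)%N]|)%N.
    rewrite ltnNge -vstat_count // -ltnNge -(ltr_nat R).
    by apply: le_lt_trans xt2; rewrite -ler_pdivrMl // mulrC.
  move=> kc; have kc' : k%:R <= c t v by rewrite ler_nat ltnW.
  have tL' : t%:R / L%:R <= k%:R / N%:R - eta / 2 by rewrite ler_pdivrMr // mulrC.
  have kNk : N%:R * (k%:R / N%:R) = k%:R :> R by rewrite mulrC mulfVK // lt0r_neq0.
  apply: le_trans (ler_norm _).
  have := ler_wpM2l (ltW NR) tL'. rewrite mulrBr kNk; lra.
have hA2 : #|A2|%:R <= 4 / (N%:R * eta ^+ 2) * (L ^ N)%:R :> R.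
  have [->|[v0]] := set_0Vmem A2.
    by rewrite cards0 !mulr_ge0 ?invr_ge0 ?mulr_ge0 ?ler0n ?ltW // exprn_gt0.
  rewrite inE => hv0; set x := L%:R * (k%:R / N%:R + eta / 2).
  have x0 : 0 <= x.
    by rewrite mulr_ge0 ?ler0n // addr_ge0 ?divr_ge0 // ltW.
  have /andP[xt1 xt2] := truncn_itv x0.
  set t := (Num.truncn x).+1.
  have tx : t%:R <= L%:R * (k%:R / N%:R + eta).
    by rewrite /t -natr1; move: xt1; rewrite /x; nra.
  have tv v : v \in A2 -> (t <= vstat v k)%N.
    rewrite inE => hv; rewrite -(ler_nat R); apply: (le_trans tx).
    by rewrite mulrC -ler_pdivlMr.
  have tL : (t <= L)%N.
    by have := tv v0; rewrite inE => /(_ hv0) /leq_trans; apply; rewrite ltnW ?vstat_lt.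
  apply: (mark t) => // v /tv; rewrite vstat_count // => kc.
  have kc' : c t v <= k%:R by rewrite ler_nat.
  have tL' : k%:R / N%:R + eta / 2 <= t%:R / L%:R.
    by rewrite ler_pdivlMr // mulrC ltW.
  have kNk : N%:R * (k%:R / N%:R) = k%:R :> R by rewrite mulrC mulfVK // lt0r_neq0.
  rewrite distrC; apply: le_trans (ler_norm _).
  have := ler_wpM2l (ltW NR) tL'. rewrite mulrDr kNk; lra.
apply: (@le_trans _ _ (#|A1|%:R + #|A2|%:R)).
  rewrite -natrD ler_nat; apply: leq_trans (leq_card_setU _ _); apply: subset_leq_card.
  apply/fintype.subsetP => v; rewrite !inE ler_normr; case/orP => h; apply/orP; [right|left]; lra.
by rewrite (le_trans (lerD hA1 hA2)) // -!mulrA -mulrDl; lra.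
Qed.

Local Open Scope classical_set_scope.
Local Open Scope ring_scope.

(** * Asymptotics of the gap counts for [L = N^3] *)

Lemma expRN_sub (R : realType) (x y : R) : 0 <= x -> expR (- x) - `|y - x| <= expR (- y).
Proof.
move=> x0; have [xy|yx] := leP x y; last first.
  have : expR (- x) <= expR (- y) by rewrite ler_expR lerN2 ltW.
  have : 0 <= `|y - x| by []. lra.
rewrite ger0_norm ?subr_ge0 //.
have e1 : 1 + (x - y) <= expR (x - y) by exact: expR_ge1Dx.
have -> : expR (- y) = expR (- x) * expR (x - y) by rewrite -expRD; congr expR; lra.
have ex1 : expR (- x) <= 1 by rewrite -expR0 ler_expR oppr_le0.
have ex0 : 0 < expR (- x) by exact: expR_gt0.
apply: (@le_trans _ _ (expR (- x) * (1 + (x - y)))); last by rewrite ler_wpM2l // ltW.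
have : expR (- x) * (y - x) <= y - x by rewrite ler_piMl // subr_ge0.
lra.
Qed.

(** The bound [1 + u <= e^u] at [u = y / (1 - y)], where [1 + u] is the inverse of [1 - y]. *)
Lemma one_sub_pow_ge (R : realType) (N : nat) (y : R) : y < 1 ->
  expR (- (N%:R * (y / (1 - y)))) <= (1 - y) ^+ N.
Proof.
move=> y1; have y10 : 0 < 1 - y by rewrite subr_gt0.
have h : 1 + y / (1 - y) <= expR (y / (1 - y)) by exact: expR_ge1Dx.
have e : 1 + y / (1 - y) = (1 - y)^-1 by field; rewrite lt0r_neq0.
rewrite -mulrN mulrC expRM_natr; apply: lerXn2r; rewrite ?nnegrE ?expR_ge0 ?(ltW y10) //.
rewrite expRN -[leRHS]invrK lef_pV2 ?posrE ?expR_gt0 ?invr_gt0 //.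
by rewrite -[leLHS]e.
Qed.

Lemma one_sub_pow_le (R : realType) (N : nat) (y : R) : y <= 1 ->
  (1 - y) ^+ N <= expR (- (N%:R * y)).
Proof.
move=> y1; rewrite -mulrN mulrC expRM_natr; apply: lerXn2r; rewrite ?nnegrE ?expR_ge0 ?subr_ge0 //.
exact: expR_ge1Dx.
Qed.

(** Restricting to distinct values costs [N] extra cells, so the single count is at least
    [(L - a - N) ^ N]. In the pair count, truncating [a] twice loses fewer than two cells, a factor
    [e^(2 / N^2)] that [1 + e] absorbs. *)
Lemma gap_asymp (R : realType) (s e : R) : 0 < s -> 0 < e ->
  \forall N \near \oo, forall L a : nat, L = (N ^ 3)%N ->
     a = Num.truncn (s * (N ^ 2)%:R) ->
  (forall k, (k.+1 < N)%N ->
     (expR (- s) - e) * (L ^ N)%:R <= #|gap_set N L a k|%:R) /\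
  (forall k l, (k < l)%N -> (l.+1 < N)%N ->
     #|gap_set N L a k :&: gap_set N L a l|%:R
       <= (expR (- s) ^+ 2 + e) * (L ^ N)%:R).
Proof.
move=> s0 e0; near=> N; move=> L a LE aE.
have N1 : 1 <= N%:R :> R by near: N; exact: nbhs_infty_ger.
have Ns : s + 2 <= N%:R :> R by near: N; exact: nbhs_infty_ger.
(* Chosen for [N * y <= (s + e) * (1 - y)] with the [y] below: as [N * y = s + 1 / N] and
   [y <= (s + 1) / N], it suffices that [(1 + (s + e) * (s + 1)) / N <= e]. *)
have Ne : (1 + (s + e) * (s + 1)) / e <= N%:R :> R by near: N; exact: nbhs_infty_ger.
have Nl : 2 / ln (1 + e) <= N%:R :> R by near: N; exact: nbhs_infty_ger.
have N0 : 0 < N%:R :> R by exact: lt_le_trans N1.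
have Nn0 : N%:R != 0 :> R by rewrite lt0r_neq0.
have LR : L%:R = N%:R ^+ 3 :> R by rewrite LE natrX.
have L0 : 0 < L%:R :> R by rewrite LR exprn_gt0.
have sN0 : 0 <= s * (N ^ 2)%:R by rewrite mulr_ge0 // ltW.
have /andP[a1 a2] := truncn_itv sN0.
rewrite -aE natrX in a1; rewrite -aE natrX -natr1 in a2.
have W0 : 0 < (L ^ N)%:R :> R by rewrite natrX exprn_gt0.
have N12 : 1 <= N%:R ^+ 2 :> R by rewrite expr_ge1.
pose y : R := (s + N%:R^-1) / N%:R.
have iN1 : N%:R^-1 <= 1 :> R by rewrite invf_le1.
have iN0 : 0 < N%:R^-1 :> R by rewrite invr_gt0.
have y1 : y < 1 by rewrite /y ltr_pdivrMr // mul1r; lra.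
have yL : L%:R * y = s * N%:R ^+ 2 + N%:R by rewrite LR /y; field.
split.
  move=> k kN; apply: (@le_trans _ _ ((L - a) ^_ N)%:R); last by rewrite ler_nat card_gap_set.
  have aNL : a%:R + N%:R <= L%:R :> R.
    have : L%:R * y <= L%:R by rewrite ler_piMr ?ltW.
    by rewrite yL; lra.
  have aL : (a + N <= L)%N by rewrite -(ler_nat R) natrD.
  apply: (@le_trans _ _ ((L - a - N) ^ N)%:R); last first.
    by rewrite ler_nat ffact_ge // leq_subRL ?(leq_trans _ aL) ?leq_addr.
  have -> : ((L - a - N) ^ N)%:R = (L%:R - a%:R - N%:R) ^+ N :> R.
    by rewrite natrX -subnDA natrB // natrD opprD addrA.
  apply: (@le_trans _ _ ((L%:R * (1 - y)) ^+ N)); last first.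
    apply: lerXn2r; rewrite ?nnegrE ?mulr_ge0 ?subr_ge0 ?(ltW y1) ?(ltW L0) //; first by lra.
    rewrite mulrBr mulr1 yL; lra.
  rewrite exprMn natrX mulrC; apply: ler_wpM2l; first by rewrite exprn_ge0 // ltW.
  apply: le_trans (one_sub_pow_ge N y1).
  apply: (@le_trans _ _ (expR (- (s + e)))).
    by have := expRN_sub (s + e) (ltW s0); rewrite [s + e - s]addrC addKr gtr0_norm.
  rewrite ler_expR lerN2 mulrA ler_pdivrMr ?subr_gt0 //.
  have -> : N%:R * y = s + N%:R^-1 by rewrite /y mulrC mulfVK.
  have ySs : y <= (s + 1) / N%:R by rewrite ler_pM2r ?invr_gt0 //; lra.
  have : (s + e) * y <= (s + e) * ((s + 1) / N%:R) by rewrite ler_wpM2l //; lra.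
  have : (1 + (s + e) * (s + 1)) / N%:R <= e.
    by rewrite ler_pdivrMr // [e * _]mulrC -ler_pdivrMr.
  rewrite mulrDl mul1r -mulrA; lra.
move=> k l kl lN; apply: (@le_trans _ _ ((L - a - a) ^ N)%:R).
  by rewrite ler_nat card_gap_set2.
have NZ : (0 < N)%N by rewrite -(ltr_nat R).
(* When [L < 2a], truncated subtraction turns the left side into [0 ^ N], which vanishes as [N] is
   positive. *)
have [aL|aL] := leqP (a + a) L; last first.
  rewrite -subnDA (eqP (ltnW aL)) exp0n // mulr_ge0 ?ltW //.
  by rewrite addr_gt0 // exprn_gt0 // expR_gt0.
have -> : ((L - a - a) ^ N)%:R = (L%:R - (a + a)%:R) ^+ N :> R.
  by rewrite natrX -subnDA natrB.
have -> : L%:R - (a + a)%:R = L%:R * (1 - (a + a)%:R / L%:R) :> R.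
  by rewrite mulrBr mulr1 [L%:R * (_ / _)]mulrC mulfVK // lt0r_neq0.
rewrite exprMn natrX mulrC; apply: ler_wpM2r; first by rewrite exprn_ge0 // ltW.
have q1 : (a + a)%:R / L%:R <= 1 :> R by rewrite ler_pdivrMr // mul1r ler_nat.
apply: (le_trans (one_sub_pow_le N q1)).
have qa : 2 * s / N%:R - 2 / L%:R <= (a + a)%:R / L%:R.
  have -> : 2 * s / N%:R - 2 / L%:R = (2 * (s * N%:R ^+ 2) - 2) / L%:R :> R.
    by rewrite LR; field.
  by rewrite ler_pM2r ?invr_gt0 // natrD; lra.
have le0 : 0 < ln (1 + e) by rewrite ln_gt0 //; lra.
apply: (@le_trans _ _ (expR (- (2 * s) + ln (1 + e)))).
  rewrite ler_expR.
  have := ler_wpM2l (ltW N0) qa.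
  have -> : N%:R * (2 * s / N%:R - 2 / L%:R) = 2 * s - 2 / N%:R ^+ 2 :> R.
    by rewrite LR; field.
  have : 2 / N%:R ^+ 2 <= ln (1 + e).
    rewrite ler_pdivrMr ?exprn_gt0 // mulrC -ler_pdivrMr //; apply: (le_trans Nl).
    by rewrite expr2 ler_peMr // ltW.
  lra.
rewrite expRD lnK ?posrE; last by lra.
have -> : expR (- (2 * s)) = expR (- s) ^+ 2.
  by rewrite -expRM_natl; congr expR; lra.
have ex1 : expR (- s) ^+ 2 <= 1 by rewrite expr_le1 ?expR_ge0 // -expR0 ler_expR; lra.
rewrite mulrDr mulr1 lerD2l ler_piMl // ltW //.
Unshelve. all: by end_near. Qed.

(** * Cells of equal probability *)

Lemma lipschitz_of_deriv (R : realType) (f : R -> R) (M : R) :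
  (forall x, derivable f x 1) -> (forall x, `|derive1 f x| <= M) ->
  forall x y, `|f y - f x| <= M * `|y - x|.
Proof.
move=> df fM; suff h x y : x < y -> `|f y - f x| <= M * `|y - x|.
  move=> x y; have [xy|yx|->] := ltgtP x y; first exact: h.
    by rewrite distrC [X in _ * X]distrC; exact: h.
  by rewrite !subrr normr0 mulr0.
move=> xy.
have h1 z : z \in `]x, y[ -> is_derive z 1 f (derive1 f z).
  by move=> _; rewrite derive1E; exact: derivableP.
have h2 : {within `[x, y], continuous f}.
  apply: continuous_subspaceT => z; apply: differentiable_continuous.
  exact/derivable1_diffP.
by have [c _ ->] := MVT xy h1 h2; rewrite normrM ler_wpM2r.
Qed.

Definition rcdf (d : measure_display) (T : measurableType d) (R : realType)
  (P : probability T R) (X : {RV P >-> R}) (x : R) : R := fine (cdf X x).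

Section cdf_facts.
Context (d : measure_display) (T : measurableType d) (R : realType)
  (P : probability T R) (X : {RV P >-> R}).
Notation F := (rcdf X).
Notation mu := (distribution P X).

Lemma rcdfE x : mu `]-oo, x] = (F x)%:E.
Proof. by rewrite /rcdf fineK //; exact: fin_num_measure. Qed.

Lemma rcdf_nd x y : x <= y -> F x <= F y.
Proof. by move=> xy; rewrite -lee_fin -!rcdfE; exact: cdf_nondecreasing. Qed.

Lemma rcdf_ge0 x : 0 <= F x.
Proof. by rewrite -lee_fin -rcdfE. Qed.

Lemma rcdf_le1 x : F x <= 1.
Proof. by rewrite -lee_fin -rcdfE; exact: probability_le1. Qed.

Lemma rcdf_itv x y : x <= y -> mu `]x, y] = (F y - F x)%:E.
Proof.
move=> xy; rewrite EFinB -!rcdfE.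
have -> : `]-oo, y]%classic = `]-oo, x] `|` `]x, y] :> set R.
  by rewrite -itv_bndbnd_setU.
rewrite measureU //=; first by rewrite addeAC subee ?add0e // fin_num_measure.
apply/seteqP; split => z //= [] /=; rewrite !in_itv /= => zx /andP[xz _].
by move: (lt_le_trans xz zx); rewrite ltxx.
Qed.

Lemma rcdf_cvgy : F x @[x --> +oo] --> (1 : R).
Proof. by apply: fine_cvg; exact: cvg_cdfy1. Qed.

Lemma rcdf_cvgNy : F x @[x --> -oo] --> (0 : R).
Proof. by apply: fine_cvg; exact: cvg_cdfNy0. Qed.

End cdf_facts.

Section density_facts.
Context (d : measure_display) (T : measurableType d) (R : realType)
  (P : probability T R) (X : {RV P >-> R}) (f : R -> R) (M : R)
  (hf : has_density X f) (fM : forall x y, `|f y - f x| <= M * `|y - x|).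
Notation F := (rcdf X).
Notation mu := (distribution P X).

Lemma density_itv_ge x y l : x <= y -> (forall z, x < z <= y -> l <= f z) ->
  l * (y - x) <= F y - F x.
Proof.
case: hf => mf f0 hmu xy hl; have [<-|xy'] := eqVneq x y.
  by rewrite !subrr mulr0.
rewrite -lee_fin -rcdf_itv // hmu //.
have xlty : x < y by rewrite lt_neqAle xy'.
(* The comparison of integrals is for nonnegative functions; for negative [l] the left side is
   nonpositive anyway. *)
have [l0|l0] := leP 0 l; last first.
  apply: (@le_trans _ _ 0%E).
    by rewrite lee_fin mulr_le0_ge0 ?subr_ge0 // ltW.
  by apply: integral_ge0 => z _; rewrite lee_fin.
have -> : (l * (y - x))%:E = (\int[lebesgue_measure]_(z in `]x, y]%classic) (cst l%:E z))%E.
  by rewrite integral_cst //= lebesgue_measure_itv /= lte_fin xlty.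
apply: ge0_le_integral => //=.
by apply/measurable_EFinP; exact: measurable_funTS.
Qed.

Lemma density_itv_le x y h : x <= y -> (forall z, x < z <= y -> f z <= h) ->
  F y - F x <= h * (y - x).
Proof.
case: hf => mf f0 hmu xy hh.
rewrite -lee_fin -rcdf_itv // hmu //.
have [->|xy'] := eqVneq x y.
  by rewrite set_itv_ge ?integral_set0 ?subrr ?mulr0 // bnd_simp ltxx.
have xlty : x < y by rewrite lt_neqAle xy'.
have h0 : 0 <= h by rewrite (le_trans (f0 y)) // hh // xlty /=.
have -> : (h * (y - x))%:E = (\int[lebesgue_measure]_(z in `]x, y]) (cst h%:E z))%E.
  by rewrite integral_cst //= lebesgue_measure_itv /= lte_fin xlty.
apply: ge0_le_integral => //=.
- by move=> z _; rewrite lee_fin.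
- by apply/measurable_EFinP; exact: measurable_funTS.
Qed.

Lemma lip_ge0 : 0 <= M.
Proof. by have := fM 0 1; rewrite subr0 normr1 mulr1; exact: le_trans. Qed.

(** Continuity of [F] in quantitative form: within distance 1 of [x] the Lipschitz bound on [f]
    gives [f <= f x + M], a local substitute for a global bound on [f]. *)
Lemma rcdf_right x e : 0 <= e -> e <= 1 -> F (x + e) - F x <= (f x + M) * e.
Proof.
move=> e0 e1; have := @density_itv_le x (x + e) (f x + M); rewrite [x + e - x]addrC addKr.
apply; first by rewrite lerDl.
move=> z /andP[xz zx]; have := fM x z; rewrite ler_norml => /andP[_ h].
have : M * `|z - x| <= M by rewrite ler_piMr ?lip_ge0 // ger0_norm; lra.
lra.
Qed.

Lemma rcdf_left x e : 0 <= e -> e <= 1 -> F x - F (x - e) <= (f x + M) * e.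
Proof.
move=> e0 e1; have := @density_itv_le (x - e) x (f x + M).
have -> : x - (x - e) = e by lra.
apply; first by rewrite gerBl.
move=> z /andP[xz zx]; have := fM x z; rewrite ler_norml => /andP[_ h].
have : M * `|z - x| <= M by rewrite ler_piMr ?lip_ge0 // ler0_norm; lra.
lra.
Qed.

Lemma density_point x : mu [set x] = 0%E.
Proof. by case: hf => mf f0 ->; rewrite ?integral_set1. Qed.

(* {F >= u} is a closed half-line whose endpoint is the u-quantile. *)
Lemma rcdf_quantile u : 0 < u -> u < 1 ->
  exists2 x, F x = u & [set y | u <= F y] = `[x, +oo[%classic.
Proof.
move=> u0 u1; set G := [set y | u <= F y].
have [y Gy] : exists y, G y.
  by have /cvgr_ge/(_ _ u1) := @rcdf_cvgy _ _ _ _ X; exact: filter_ex.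
have [z Gz] : exists z, ~ G z.
  have /cvgr_lt/(_ _ u0)/filter_ex[z Fz] := @rcdf_cvgNy _ _ _ _ X.
  by exists z; rewrite /G /= leNgt Fz.
have hz : lbound G z.
  move=> t Gt; rewrite leNgt; apply/negP => tz; apply: Gz.
  by apply: le_trans Gt _; apply: rcdf_nd; exact: ltW.
have hi : has_inf G by split; [exists y|exists z].
set x := inf G.
have xG t : G t -> x <= t by move=> Gt; exact: (ge_inf hi.2).
have h0 : 0 <= f x + M by rewrite addr_ge0 ?lip_ge0 //; case: hf.
have Fx1 : u <= F x.
  apply/ler_addgt0Pr => e e0.
  (* At most 1, as [rcdf_right] demands; the added 1 keeps the denominator positive. *)
  pose dl := Num.min 1 (e / (f x + M + 1)).
  have dl0 : 0 < dl by rewrite lt_min ltr01 divr_gt0 // ltr_wpDl.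
  have [t Gt tx] := inf_adherent dl0 hi.
  have : F t <= F (x + dl) by apply: rcdf_nd; exact: ltW.
  have := @rcdf_right x dl (ltW dl0); rewrite ge_min lexx => /(_ isT).
  have : (f x + M) * dl <= e.
    apply: (@le_trans _ _ ((f x + M + 1) * dl)); first by rewrite ler_wpM2r ?ltW //; lra.
    by rewrite mulrC -ler_pdivlMr ?ltr_wpDl // ge_min lexx orbT.
  by move: Gt; rewrite /G /=; lra.
have Fx2 : F x <= u.
  apply/ler_addgt0Pr => e e0.
  pose dl := Num.min 1 (e / (f x + M + 1)).
  have dl0 : 0 < dl by rewrite lt_min ltr01 divr_gt0 // ltr_wpDl.
  have : ~ G (x - dl) by move=> /xG; lra.
  move=> /negP; rewrite -ltNge.
  have := @rcdf_left x dl (ltW dl0); rewrite ge_min lexx => /(_ isT).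
  have : (f x + M) * dl <= e.
    apply: (@le_trans _ _ ((f x + M + 1) * dl)); first by rewrite ler_wpM2r ?ltW //; lra.
    by rewrite mulrC -ler_pdivlMr ?ltr_wpDl // ge_min lexx orbT.
  lra.
exists x; first by apply/le_anti; rewrite Fx1 Fx2.
apply/seteqP; split => t /=; rewrite in_itv /= andbT; first exact: xG.
by move=> xt; apply: (le_trans Fx1); exact: rcdf_nd.
Qed.

(** The probability integral transform: [F(X)] is uniform. The value [u = 0] is treated apart
    because [F] may have no zero, hence no 0-quantile. *)
Lemma distribution_rcdf_ge u : 0 <= u -> u < 1 ->
  mu [set y | u <= F y] = (1 - u)%:E /\ measurable [set y | u <= F y].
Proof.
rewrite le_eqVlt => /predU1P[<-|u0] u1.
  have -> : [set y | 0 <= F y] = setT.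
    by apply/seteqP; split => // y _; exact: rcdf_ge0.
  by rewrite probability_setT subr0; split.
have [x Fx ->] := rcdf_quantile u0 u1; split => //.
have -> : `[x, +oo[%classic = x |` ~` `]-oo, x] :> set R.
  apply/seteqP; split => t /=; rewrite !in_itv /= ?andbT.
    by rewrite le_eqVlt => /predU1P[->|]; [left|right; apply/negP; rewrite -ltNge].
  by move=> [->|/negP] //; rewrite -ltNge => /ltW.
rewrite measureU //=; [|exact: measurableC|].
  rewrite density_point add0e probability_setC // EFinB -Fx.
  by congr (_ - _)%E; exact: rcdfE.
by apply/seteqP; split => t //= [-> ]; rewrite in_itv /= lexx.
Qed.

End density_facts.

Lemma measure_mem_seq (d : measure_display) (T : measurableType d)
    (R : realType) (P : probability T R) (A : eqType) (V : T -> A) (q : R)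
    (s : seq A) :
  (forall v, measurable [set w | V w = v] /\ (P [set w | V w = v] <= q%:E)%E) ->
  measurable [set w | V w \in s] /\
  (P [set w | V w \in s] <= ((size s)%:R * q)%:E)%E.
Proof.
move=> hV; elim: s => [|v s [mS hS]] /=.
  have -> : [set w | V w \in [::]] = set0 by apply/seteqP; split.
  by rewrite measure0 mul0r.
have -> : [set w | V w \in v :: s] = [set w | V w = v] `|` [set w | V w \in s].
  apply/seteqP; split => w /=; rewrite inE.
    by move=> /predU1P[]; [left|right].
  by move=> [->|->]; rewrite ?eqxx ?orbT.
have [mv hv] := hV v; split; first exact: measurableU.
apply: le_trans (measureU2 _ mv mS) _; rewrite -natr1 mulrDl mul1r EFinD addeC.
exact: leeD.
Qed.

Section cells.
Context (d : measure_display) (T : measurableType d) (R : realType)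
  (P : probability T R) (X : nat -> {RV P >-> R}) (f : R -> R) (M : R).
Notation F := (rcdf (X 0)).

(* The cap at L - 1 only matters where F = 1. *)
Definition celln (L : nat) (x : R) : nat :=
  minn (Num.truncn (L%:R * F x)) L.-1.

Lemma celln_lt L x : (0 < L)%N -> (celln L x < L)%N.
Proof. by move=> L0; rewrite /celln gtn_min [X in _ || X](_ : _ = true) ?orbT //; lia. Qed.

Lemma LF_ge0 L x : 0 <= L%:R * F x.
Proof. by rewrite mulr_ge0 // rcdf_ge0. Qed.

Lemma celln_homo L x y : x <= y -> (celln L x <= celln L y)%N.
Proof.
move=> xy; rewrite /celln leq_min geq_minr andbT geq_min; apply/orP; left.
by rewrite le_truncn // ler_wpM2l // rcdf_nd.
Qed.

(** The upper bound is weak because of the cap: where [F x = 1] the cell is [L - 1] and equality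
    holds. *)
Lemma celln_bounds L x : (0 < L)%N ->
  (celln L x)%:R <= L%:R * F x <= (celln L x)%:R + 1.
Proof.
move=> L0; have /andP[h1 h2] := truncn_itv (LF_ge0 L x); apply/andP; split.
  by apply: le_trans h1; rewrite ler_nat geq_minl.
rewrite /celln /minn; case: ifP => _; first by rewrite natr1 ltW.
by rewrite natr1 prednK // ler_piMr // rcdf_le1.
Qed.

Definition cell (L : nat) (L0 : (0 < L)%N) (x : R) : 'I_L := Ordinal (celln_lt x L0).

Definition cellv (N L : nat) (L0 : (0 < L)%N) (w : T) : {ffun 'I_N -> 'I_L} :=
  [ffun j : 'I_N => cell L0 (X j w)].

(** A monotone map commutes with sorting. The predecessor passes from order statistics counted from
    1 to those counted from 0. *)
Lemma vstat_cellv N L (L0 : (0 < L)%N) k w : (0 < k)%N -> (k <= N)%N ->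
  vstat (cellv N L0 w) k.-1 = celln L (order_stat X N k w).
Proof.
move=> k0 kN; rewrite /vstat /order_stat.
have -> : vals (cellv N L0 w) = map (celln L) (mkseq (fun j => X j w) N).
  rewrite /vals /mkseq -val_enum_ord -!map_comp; apply: eq_map => j /=.
  by rewrite ffunE.
rewrite (sort_map_homo (r := <=%R) (@le_total _ _) leq_total leq_trans anti_leq); last first.
  by move=> x y _ _; exact: celln_homo.
by rewrite (nth_map 0) // size_sort size_mkseq; case: (k) k0 kN.
Qed.

Context (hindep : independent_RVs X) (hident : identically_distributed X)
  (hf : has_density (X 0) f) (fM : forall x y, `|f y - f x| <= M * `|y - x|).

(** Cell [v] is the difference of the half-lines [v / L <= F] and [(v + 1) / L <= F], whose masses
    differ by [1 / L]. *)
Lemma cell_preim L (L0 : (0 < L)%N) (v : 'I_L) :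
  measurable [set x | cell L0 x = v] /\
  (distribution P (X 0) [set x | cell L0 x = v] <= (L%:R^-1)%:E)%E.
Proof.
have LR : 0 < L%:R :> R by rewrite ltr0n.
pose G u := [set y | u <= F y].
have cellP t x : (t < L)%N -> (t <= celln L x)%N = (t%:R / L%:R <= F x).
  move=> tL; rewrite ler_pdivrMr // mulrC /celln leq_min [X in _ && X](_ : _ = true); last lia.
  by rewrite andbT truncn_ge_nat // LF_ge0.
have u0 : 0 <= v%:R / L%:R :> R by rewrite divr_ge0.
have u1 : v%:R / L%:R < 1 :> R by rewrite ltr_pdivrMr // mul1r ltr_nat.
have [muv mv] := distribution_rcdf_ge hf fM u0 u1.
(* The last cell is a single half-line, since the cap puts the points with [F = 1] into it. *)
have [vL|vL] := ltnP v.+1 L; last first.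
  have -> : [set x | cell L0 x = v] = G (v%:R / L%:R).
    apply/seteqP; split => x /=.
      by move=> <-; rewrite /G /= -cellP ?celln_lt.
    rewrite /G /= -cellP // => h; apply/val_inj => /=; apply/eqP.
    by rewrite eqn_leq h andbT -ltnS (leq_trans _ vL) ?celln_lt.
  split => //; rewrite muv lee_fin.
  have -> : L%:R = v.+1%:R :> R by congr _%:R; apply/eqP; rewrite eqn_leq vL ltn_ord.
  rewrite -natr1 le_eqVlt; apply/orP; left; apply/eqP; field.
  by rewrite natr1 pnatr_eq0.
have u0' : 0 <= v.+1%:R / L%:R :> R by rewrite divr_ge0.
have u1' : v.+1%:R / L%:R < 1 :> R by rewrite ltr_pdivrMr // mul1r ltr_nat.
have [muv' mv'] := distribution_rcdf_ge hf fM u0' u1'.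
have -> : [set x | cell L0 x = v] = G (v%:R / L%:R) `\` G (v.+1%:R / L%:R).
  apply/seteqP; split => x /=.
    move=> xv; have {}xv : celln L x = v by rewrite -xv.
    by rewrite /G /= -!cellP // xv leqnn ltnn.
  rewrite /G /= -!cellP // => -[h1 /negP]; rewrite -leqNgt => h2.
  by apply/val_inj => /=; apply/eqP; rewrite eqn_leq h1 h2.
split; first exact: measurableD.
rewrite measureD //=; last by rewrite (le_lt_trans (probability_le1 _ mv)) ?ltry.
have -> : G (v%:R / L%:R) `&` G (v.+1%:R / L%:R) = G (v.+1%:R / L%:R).
  apply/setIidr => x; apply: le_trans; rewrite ler_pM2r ?invr_gt0 // ler_nat //.
rewrite muv muv' -EFinB lee_fin -natr1 mulrDl mul1r; lra.
Qed.

Lemma cellv_preim N L (L0 : (0 < L)%N) (v : {ffun 'I_N -> 'I_L}) :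
  measurable [set w | cellv N L0 w = v] /\
  (P [set w | cellv N L0 w = v] <= ((L ^ N)%:R^-1)%:E)%E.
Proof.
(* Independence is stated for a set at every natural index; beyond the first [N] indices [setT]
   serves as filler. *)
pose A (j : nat) : set R := if insub j is Some i then [set x | cell L0 x = v i] else setT.
have mA j : measurable (A j).
  by rewrite /A; case: insub => // i; exact: (cell_preim L0 (v i)).1.
pose S : {fset nat} := [fset j in iota 0 N]%fset.
have SE : [set w | cellv N L0 w = v] = \bigcap_(j in [set` S]) (X j @^-1` A j).
  apply/seteqP; split => w /=.
    move=> wv j _; rewrite /A /=; case: insubP => //= i _ ij.
    by rewrite -wv ffunE ij.
  move=> h; apply/ffunP => i; rewrite ffunE.
  have := h i; rewrite /A /= valK; apply.
  by rewrite !inE mem_iota /=.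
rewrite SE; split.
  by apply: fin_bigcap_measurable => // j _; exact: measurable_funPTI.
rewrite hindep //.
have SN : perm_eq (S : seq nat) (iota 0 N).
  apply: uniq_perm; rewrite ?iota_uniq ?fset_uniq // => j.
  by rewrite !inE.
rewrite (perm_big _ SN) /=.
have -> : (L ^ N)%:R^-1 = \prod_(j <- iota 0 N) L%:R^-1 :> R.
  have -> : iota 0 N = index_iota 0 N by rewrite /index_iota subn0.
  by rewrite prodr_const_nat subn0 natrX exprVn.
rewrite -prodEFin big_seq [leRHS]big_seq.
suff [_] : (0 <= \prod_(j <- iota 0 N | j \in iota 0 N) P (X j @^-1` A j) /\
  \prod_(j <- iota 0 N | j \in iota 0 N) P (X j @^-1` A j) <=
  \prod_(j <- iota 0 N | j \in iota 0 N) (L%:R^-1)%:E)%E by [].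
apply: (big_rec2 (fun x y : \bar R => (0 <= x)%E /\ (x <= y)%E)).
  by split; rewrite ?lee_fin.
move=> j x y; rewrite mem_iota /= add0n => jN [x0 xy].
split; first by rewrite mule_ge0.
apply: lee_pmul => //; rewrite /A insubT.
have := (cell_preim L0 (v (Ordinal jN))).2.
by rewrite (hident 0 j) //; exact: (cell_preim L0 _).1.
Qed.

(** The bridge from counting to probability. An upper bound is enough, because it is applied to sets
    of exceptional tuples. *)
Lemma cellv_prob N L (L0 : (0 < L)%N) (C : {set {ffun 'I_N -> 'I_L}}) :
  measurable [set w | cellv N L0 w \in C] /\
  (P [set w | cellv N L0 w \in C] <= (#|C|%:R / (L ^ N)%:R)%:E)%E.
Proof.
have -> : [set w | cellv N L0 w \in C] = [set w | cellv N L0 w \in enum C].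
  by apply/seteqP; split => w /=; rewrite mem_enum.
rewrite cardE; exact: measure_mem_seq (cellv_preim L0).
Qed.
End cells.

(** * Convergence in probability of the gap frequencies *)

Section whp.
Context (d : measure_display) (T : measurableType d) (R : realType)
  (P : probability T R).

(* [E N] is not required to be measurable. *)
Definition whp (E : nat -> set T) : Prop :=
  forall e : R, 0 < e -> \forall N \near \oo,
    exists M, [/\ measurable M, ~` E N `<=` M & (P M <= e%:E)%E].

Lemma whp_sub (E E' : nat -> set T) : whp E ->
  (\forall N \near \oo, E N `<=` E' N) -> whp E'.
Proof.
move=> hE hs e e0; near=> N.
have [M [mM EM PM]] : exists M, [/\ measurable M, ~` E N `<=` M & (P M <= e%:E)%E].
  by near: N; exact: hE.
exists M; split => //; apply: subset_trans EM; apply: subsetC.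
by near: N.
Unshelve. all: by end_near. Qed.

Lemma whpI (E E' : nat -> set T) : whp E -> whp E' -> whp (fun N => E N `&` E' N).
Proof.
move=> hE hE' e e0; have e20 : 0 < e / 2 by rewrite divr_gt0.
near=> N.
have [M [mM EM PM]] : exists M, [/\ measurable M, ~` E N `<=` M & (P M <= (e / 2)%:E)%E].
  by near: N; exact: hE.
have [M' [mM' EM' PM']] : exists M, [/\ measurable M, ~` E' N `<=` M & (P M <= (e / 2)%:E)%E].
  by near: N; exact: hE'.
exists (M `|` M'); split.
- exact: measurableU.
- by rewrite setCI; exact: setUSS.
- apply: le_trans (measureU2 _ mM mM') _.
  by rewrite [e]splitr EFinD; exact: leeD.
Unshelve. all: by end_near. Qed.

Lemma whpT : whp (fun=> setT).
Proof.
move=> e e0; near=> N; exists set0; rewrite setCT measure0 lee_fin; split => //.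
exact: ltW.
Unshelve. all: by end_near. Qed.

Lemma whp_all (A : eqType) (s : seq A) (E : A -> nat -> set T) :
  (forall x, x \in s -> whp (E x)) ->
  whp (fun N => [set w | forall x, x \in s -> E x N w]).
Proof.
elim: s => [|y s IH] h.
  by apply: whp_sub whpT _; near=> N => w _ x; rewrite in_nil.
have h1 : whp (E y) by apply: h; rewrite inE eqxx.
have h2 := IH (fun x xs => h x (mem_behead (s := y :: s) xs)).
apply: whp_sub (whpI h1 h2) _; near=> N => w [Ey Es] x.
by rewrite inE => /predU1P[->//|]; exact: Es.
Unshelve. all: by end_near. Qed.

Lemma whp_cvg1 (E : nat -> set T) : (forall N, measurable (E N)) ->
  P (E N) @[N --> \oo] --> 1%E -> whp E.
Proof.
move=> mE PE e e0.
have fE N : P (E N) \is a fin_num by exact: fin_num_measure.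
have : fine (P (E N)) @[N --> \oo] --> (1 : R) by exact: fine_cvg.
move=> /cvgr_ge/(_ (1 - e)) hh; have {}hh := hh (ltac:(lra)).
near=> N; exists (~` E N); split => //; first exact: measurableC.
rewrite probability_setC // -(fineK (fE N)) -EFinB lee_fin.
have : 1 - e <= fine (P (E N)) by near: N.
lra.
Unshelve. all: by end_near. Qed.

Lemma whp_cvg0 (E : nat -> set T) : (forall N, measurable (E N)) ->
  whp (fun N => ~` E N) -> P (E N) @[N --> \oo] --> 0%E.
Proof.
move=> mE hE; apply/fine_cvgP; split.
  by near=> N; exact: fin_num_measure.
apply/cvgr0Pnorm_le => e e0; near=> N => /=.
have [M [mM EM PM]] : exists M, [/\ measurable M, ~` (~` E N) `<=` M & (P M <= e%:E)%E].
  by near: N; exact: hE.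
rewrite ger0_norm ?fine_ge0 // -lee_fin fineK ?fin_num_measure //.
apply: le_trans PM; apply: le_measure; rewrite ?inE //.
by rewrite -[E N]setCK.
Unshelve. all: by end_near. Qed.

End whp.

(* N^3, written as a successor so that it is positive for every N. *)
Definition cube (N : nat) : nat := (N ^ 3).-1.+1.

Lemma cubeE N : (0 < N)%N -> cube N = (N ^ 3)%N.
Proof. by move=> N0; rewrite /cube prednK // expn_gt0 N0. Qed.

Section whp_cells.
Context (d : measure_display) (T : measurableType d) (R : realType)
  (P : probability T R) (X : nat -> {RV P >-> R}) (f : R -> R) (M : R)
  (hindep : independent_RVs X) (hident : identically_distributed X)
  (hf : has_density (X 0) f) (fM : forall x y, `|f y - f x| <= M * `|y - x|).

Definition cubev N w : {ffun 'I_N -> 'I_(cube N)} := cellv X N (ltn0Sn _) w.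

Lemma whp_cells (K : forall N, {set {ffun 'I_N -> 'I_(cube N)}}) :
  (forall e : R, 0 < e -> \forall N \near \oo,
     #|K N|%:R <= e * (cube N ^ N)%:R) ->
  whp P (fun N => [set w | cubev N w \notin K N]).
Proof.
move=> hK e e0; near=> N.
have [mK PK] := cellv_prob hindep hident hf fM (ltn0Sn (N ^ 3).-1) (K N).
exists [set w | cubev N w \in K N]; split => //.
  by move=> w /= /negP; rewrite negbK.
apply: le_trans PK _; rewrite lee_fin ler_pdivrMr; last by rewrite ltr0n expn_gt0.
by near: N; exact: hK.
Unshelve. all: by end_near. Qed.

Lemma whp_location (k : nat -> nat) (eta : R) : 0 < eta ->
  (\forall N \near \oo, (k N < N)%N) ->
  whp P (fun N => [set w | `|(vstat (cubev N w) (k N))%:R / (cube N)%:R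
                          - (k N)%:R / N%:R| < eta]).
Proof.
move=> eta0 kN.
pose K N : {set _} := [set v : {ffun 'I_N -> 'I_(cube N)} |
   eta <= `|(vstat v (k N))%:R / (cube N)%:R - (k N)%:R / N%:R|]%SET.
suff hK : forall e : R, 0 < e -> \forall N \near \oo,
    #|K N|%:R <= e * (cube N ^ N)%:R.
  apply: whp_sub (whp_cells hK) _.
  by near=> N => w /=; rewrite inE -ltNge.
move=> e e0; near=> N.
have N1 : 1 <= N%:R :> R by near: N; exact: nbhs_infty_ger.
have N0 : (0 < N)%N by rewrite -(ler_nat R).
have Ne : 8 / (e * eta ^+ 2) <= N%:R :> R by near: N; exact: nbhs_infty_ger.
have Nt : 2 / eta <= N%:R :> R by near: N; exact: nbhs_infty_ger.
apply: le_trans (vstat_dev_card _ eta0 _) _.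
- by near: N.
- rewrite -ler_pdivrMr //; apply: (le_trans Nt); rewrite cubeE // ler_nat.
  by rewrite -{1}[N]expn1 leq_pexp2l.
- apply: ler_wpM2r => //.
  rewrite ler_pdivrMr ?mulr_gt0 ?exprn_gt0 ?ltr0n //.
  move: Ne; rewrite ler_pdivrMr ?mulr_gt0 ?exprn_gt0 //; lra.
Unshelve. all: by end_near. Qed.

(** [i N] counts from 1 and [gap_set] from 0, hence the index [(i N).-1 + k]. *)
Lemma whp_spacing (i m : nat -> nat) (s e : R) : 0 < s -> 0 < e ->
  (\forall N \near \oo, (0 < i N)%N /\ (i N + m N <= N)%N) ->
  (forall A : R, \forall N \near \oo, A <= (m N)%:R) ->
  whp P (fun N => [set w | `|(\sum_(k < m N)
     (cubev N w \in gap_set N (cube N) (Num.truncn (s * (N ^ 2)%:R)) ((i N).-1 + k)))%:R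
       / (m N)%:R - expR (- s)| < e]).
Proof.
move=> s0 e0 him hm.
pose K N : {set _} := [set v : {ffun 'I_N -> 'I_(cube N)} |
   e <= `|(\sum_(k < m N)
     (v \in gap_set N (cube N) (Num.truncn (s * (N ^ 2)%:R)) ((i N).-1 + k)))%:R
       / (m N)%:R - expR (- s)|]%SET.
suff hK : forall e : R, 0 < e -> \forall N \near \oo,
    #|K N|%:R <= e * (cube N ^ N)%:R.
  apply: whp_sub (whp_cells hK) _.
  by near=> N => w /=; rewrite inE -ltNge.
(* Three times this error is half of [e' * e ^+ 2]; the other half is left for [1 / m N]. *)
move=> e' e'0; have eta0 : 0 < e' * e ^+ 2 / 6 by rewrite divr_gt0 // mulr_gt0 // exprn_gt0.
near=> N.
have N1 : 1 <= N%:R :> R by near: N; exact: nbhs_infty_ger.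
have N0 : (0 < N)%N by rewrite -(ler_nat R).
have m1 : 1 <= (m N)%:R :> R by near: N; exact: hm.
have m0 : (0 < m N)%N by rewrite -(ler_nat R).
have [i0 imN] : (0 < i N)%N /\ (i N + m N <= N)%N by near: N.
have [h1 h2] : (forall k, (k.+1 < N)%N ->
     (expR (- s) - (e' * e ^+ 2 / 6)) * (cube N ^ N)%:R
       <= #|gap_set N (cube N) (Num.truncn (s * (N ^ 2)%:R)) k|%:R) /\
  (forall k l, (k < l)%N -> (l.+1 < N)%N ->
     #|gap_set N (cube N) (Num.truncn (s * (N ^ 2)%:R)) k :&:
       gap_set N (cube N) (Num.truncn (s * (N ^ 2)%:R)) l|%:R
       <= (expR (- s) ^+ 2 + (e' * e ^+ 2 / 6)) * (cube N ^ N)%:R).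
  have [a aE] : exists a, a = Num.truncn (s * (N ^ 2)%:R).
    by exists (Num.truncn (s * (N ^ 2)%:R)).
  rewrite -aE; move: (cube N) (cubeE N0) a aE.
  near: N; apply: filterS (gap_asymp s0 eta0) => N h L LE a aE; exact: h.
have jm : ((i N).-1 + m N < N)%N by rewrite -(prednK i0) addSn in imN.
have p01 : 0 <= expR (- s) <= 1.
  by rewrite expR_ge0 /= -expR0 ler_expR oppr_le0 ltW.
have := gap_freq_card jm m0 p01 (ltW eta0) (ltW e0) h1 h2.
rewrite -ler_pdivlMr ?exprn_gt0 // => /le_trans; apply.
rewrite mulrAC; apply: ler_wpM2r => //.
rewrite ler_pdivrMr ?exprn_gt0 //.
have mb : 2 / (e' * e ^+ 2) <= (m N)%:R by near: N; exact: hm.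
have : (m N)%:R^-1 <= e' * e ^+ 2 / 2.
  rewrite -[leRHS]invrK lef_pV2 ?posrE ?ltr0n // ?invr_gt0 ?divr_gt0 ?mulr_gt0 ?exprn_gt0 //.
  by rewrite invf_div.
lra.
Unshelve. all: by end_near. Qed.

End whp_cells.

(** An infimum over [J] need not be attained, as [J] may fail to be closed; it is only approached
    within [e]. *)
Lemma near_minimizer (R : realType) (J : set R) (g : R -> R) (e : R) :
  (forall x, 0 <= g x) -> J !=set0 -> 0 < e ->
  exists q, J q /\ forall x, J x -> g q <= g x + e.
Proof.
move=> g0 [x0 Jx0] e0.
have hi : has_inf (g @` J).
  by split; [exists (g x0), x0|exists 0 => _ [x _ <-]].
have [_ [q Jq <-] hq] := inf_adherent e0 hi.
exists q; split => // x Jx; apply: (le_trans (ltW hq)); rewrite lerD2r.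
by apply: (ge_inf hi.2); exists x.
Qed.

Lemma count_iota_sum (p : pred nat) (i m : nat) :
  count p (index_iota i (i + m)) = (\sum_(k < m) p (i + k)%N)%N.
Proof.
rewrite -sum1_count big_mkcond /= -[i in index_iota i _]add0n.
rewrite [(i + m)%N]addnC big_addn addnK big_mkord.
by apply: eq_bigr => k _; rewrite addnC; case: (p _).
Qed.

Lemma order_stat_homo (T : Type) (R : realType) (X : nat -> T -> R) (N k l : nat) w :
  (0 < k)%N -> (k <= l)%N -> (l <= N)%N -> order_stat X N k w <= order_stat X N l w.
Proof.
move=> k0 kl lN; apply: (sorted_leq_nth le_trans) => //; last by lia.
- exact: sort_sorted (@le_total _ _) _.
- by rewrite inE size_sort size_mkseq; lia.
- by rewrite inE size_sort size_mkseq; lia.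
Qed.

(** * Comparison of the spacings with the cells *)

Section good.
Context (d : measure_display) (T : measurableType d) (R : realType)
  (P : probability T R) (X : nat -> {RV P >-> R}) (f : R -> R) (M : R)
  (hindep : independent_RVs X) (hident : identically_distributed X)
  (hf : has_density (X 0) f) (fM : forall x y, `|f y - f x| <= M * `|y - x|).
Notation F := (rcdf (X 0)).
Context (J : set R) (c : R) (hJ : is_interval J) (c0 : 0 < c)
  (fJ : forall x, J x -> c <= f x).

(** As [f >= c] on [J], the inverse of [F] is Lipschitz there: closeness of values of [F] gives
    closeness of points. *)
Lemma expansion x y : J x -> J y -> c * `|y - x| <= `|F y - F x|.
Proof.
suff h u v : J u -> J v -> u <= v -> c * `|v - u| <= `|F v - F u|.
  move=> Jx Jy; have [xy|yx] := leP x y; first exact: h.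
  by rewrite distrC [leRHS]distrC; apply: h => //; exact: ltW.
move=> Ju Jv uv; rewrite !ger0_norm ?subr_ge0 ?rcdf_nd //.
apply: (density_itv_ge hf uv) => z /andP[uz zv]; apply: fJ.
by apply: (hJ Ju Jv); rewrite ltW.
Qed.

Lemma window_dist x0 x1 q z d1 d2 : J x0 -> J x1 -> J q -> x0 <= z <= x1 ->
  `|F q - F x0| <= d1 -> F x1 - F x0 <= d2 -> c * `|z - q| <= d1 + d2.
Proof.
move=> J0 J1 Jq /andP[xz zx] h1 h2.
have Jz : J z by apply: (hJ J0 J1); rewrite xz.
apply: (le_trans (expansion Jq Jz)).
have z0 := rcdf_nd (X 0) xz; have z1 := rcdf_nd (X 0) zx.
have : `|F z - F q| <= `|F z - F x0| + `|F x0 - F q| by exact: ler_distD.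
rewrite (distrC (F x0)) (@ger0_norm _ (F z - F x0)) ?subr_ge0 //; lra.
Qed.

Lemma gap_compare x y q t : x <= y -> (forall z, x < z <= y -> M * `|z - q| <= t * f q) ->
  (1 - t) * f q * (y - x) <= F y - F x <= (1 + t) * f q * (y - x).
Proof.
move=> xy h; apply/andP; split.
  apply: (density_itv_ge hf xy) => z /h h'.
  by have := fM q z; rewrite ler_norml => /andP[+ _]; lra.
apply: (density_itv_le hf xy) => z /h h'.
by have := fM q z; rewrite ler_norml => /andP[_ +]; lra.
Qed.

(** Rounding to cells changes [L * (F y - F x)] by at most one cell. The two hypotheses on
    [N%:R ^+ 2] leave this room on either side of [s], after the factors [1 - t] and [1 + t] coming
    from the density. *)
Lemma gap_cells (N L : nat) (x y q t s s1 s2 : R) : (0 < L)%N -> L%:R = N%:R ^+ 3 :> R ->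
  x <= y -> 0 < t -> t < 1 -> 0 < s1 -> 0 < s2 -> 0 < s ->
  1 < N%:R ^+ 2 * ((1 - t) * s - s1) -> 1 <= N%:R ^+ 2 * (s2 - (1 + t) * s) ->
  (1 - t) * f q * (y - x) <= F y - F x <= (1 + t) * f q * (y - x) ->
  (s <= N%:R * f q * (y - x) ->
    (Num.truncn (s1 * (N ^ 2)%:R) + celln X L x < celln X L y)%N) /\
  ((Num.truncn (s2 * (N ^ 2)%:R) + celln X L x < celln X L y)%N ->
    s < N%:R * f q * (y - x)).
Proof.
move=> L0 LE xy t0 t1 s10 s20 s0 h1 h2 /andP[hl hu].
have /andP[xl xu] := celln_bounds X x L0.
have /andP[yl yu] := celln_bounds X y L0.
have N2 : 0 <= N%:R ^+ 2 :> R by rewrite exprn_ge0.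
have N20 : 0 < N%:R ^+ 2 :> R.
  by rewrite lt0r N2 andbT; apply/eqP => N20; move: h1; rewrite N20 mul0r; lra.
have LD : L%:R * (F y - F x) = N%:R ^+ 2 * (N%:R * (F y - F x)).
  by rewrite LE exprSr mulrA.
have N0 : 0 <= N%:R :> R by [].
set a := celln X L x in xl xu *; set b := celln X L y in yl yu *.
set D := N%:R * f q * (y - x).
have hl' : N%:R ^+ 2 * ((1 - t) * D) <= L%:R * (F y - F x).
  rewrite LD ler_pM2l //; have := ler_wpM2l N0 hl; rewrite /D; lra.
have hu' : L%:R * (F y - F x) <= N%:R ^+ 2 * ((1 + t) * D).
  rewrite LD ler_pM2l //; have := ler_wpM2l N0 hu; rewrite /D; lra.
have cx0 : 0 <= a%:R :> R by [].
split => h.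
  have q1 : 0 <= s1 * (N ^ 2)%:R by rewrite mulr_ge0 // ltW.
  have /andP[tr _] := truncn_itv q1; rewrite natrX in tr.
  have e1 : N%:R ^+ 2 * ((1 - t) * s) <= N%:R ^+ 2 * ((1 - t) * D).
    by rewrite ler_pM2l // ler_pM2l ?subr_gt0.
  rewrite -(ltr_nat R) natrD natrX; lra.
have q2 : 0 <= s2 * (N ^ 2)%:R by rewrite mulr_ge0 // ltW.
have /andP[_ tr] := truncn_itv q2; rewrite -natr1 natrX in tr.
rewrite -(ler_nat R) -natr1 natrD natrX in h.
have t10 : 0 < 1 + t by lra.
rewrite -(ltr_pM2l t10) -(ltr_pM2l N20); lra.
Qed.

Context (i m : nat -> nat) (q : nat -> R).
Context (him : \forall N \near \oo, (0 < i N)%N /\ (i N + m N <= N)%N)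
  (hm : forall A : R, \forall N \near \oo, A <= (m N)%:R)
  (hmN : forall e : R, 0 < e -> \forall N \near \oo, (m N)%:R <= e * N%:R)
  (hq : \forall N \near \oo, J (q N) /\ forall x, J x ->
     `|F (q N) - (i N)%:R / N%:R| <= `|F x - (i N)%:R / N%:R| + N%:R^-1)
  (hiJ : whp P (fun N => [set w | forall k : nat, (i N <= k <= i N + m N)%N ->
                J (order_stat X N k w)])).

Definition gap N k w := N%:R * f (q N) * (order_stat X N k.+1 w - order_stat X N k w).

(** Both ends of the block have [F] close to [i_N / N], because [m N / N] tends to 0. [expansion]
    turns this into closeness of the whole block to [q N], where the Lipschitz bound makes [f]
    nearly constant. *)
Lemma whp_compare (t : R) : 0 < t ->
  whp P (fun N => [set w | forall k, (i N <= k < i N + m N)%N ->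
    let x := order_stat X N k w in let y := order_stat X N k.+1 w in
    x <= y /\
    (1 - t) * f (q N) * (y - x) <= F y - F x <= (1 + t) * f (q N) * (y - x)]).
Proof.
move=> t0.
have M0 : 0 <= M by exact: lip_ge0 fM.
(* The aim is [M * |z - q N| <= t * c <= t * f (q N)], starting from [c * |z - q N| <= 6 * eta];
   [M + 1] avoids a zero denominator. *)
pose eta := t * c ^+ 2 / (6 * (M + 1)).
have M1 : 0 < 6 * (M + 1) by rewrite mulr_gt0 //; lra.
have eta0 : 0 < eta by rewrite divr_gt0 // mulr_gt0 // exprn_gt0.
have M1E : (M + 1) * (6 * eta) = t * c ^+ 2.
  by rewrite /eta; field; rewrite lt0r_neq0 //; lra.
have k1 : \forall N \near \oo, ((i N).-1 < N)%N.
  by apply: filterS him => N [i0 iN]; lia.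
have k2 : \forall N \near \oo, ((i N + m N).-1 < N)%N.
  near=> N; have [i0 iN] : (0 < i N)%N /\ (i N + m N <= N)%N by near: N.
  have : 1 <= (m N)%:R :> R by near: N; exact: hm.
  rewrite ler1n; lia.
have w1 := whp_location hindep hident hf fM eta0 k1.
have w2 := whp_location hindep hident hf fM eta0 k2.
apply: whp_sub (whpI hiJ (whpI w1 w2)) _; near=> N => w [hJw [/= l1 l2]] k /andP[ik km].
have [i0 imN] : (0 < i N)%N /\ (i N + m N <= N)%N by near: N.
have [Jq qopt] : J (q N) /\ forall x, J x ->
     `|F (q N) - (i N)%:R / N%:R| <= `|F x - (i N)%:R / N%:R| + N%:R^-1 by near: N.
have N1 : 1 <= N%:R :> R by near: N; exact: nbhs_infty_ger.
have Nn0 : (0 < N)%N by rewrite -(ler_nat R).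
(* The distances [d1] and [d2] below add up to [5 * eta + 7 / N], hence to at most [6 * eta]. *)
have Neta : 7 / eta <= N%:R :> R by near: N; exact: nbhs_infty_ger.
have mN : (m N)%:R <= eta * N%:R by near: N; exact: hmN.
have N0 : 0 < N%:R :> R by rewrite ltr0n.
set o := fun k => order_stat X N k w.
have k0 : (0 < k)%N := leq_trans i0 ik.
have kN : (k < N)%N := leq_trans km imN.
have ok : o k <= o k.+1 by exact: order_stat_homo.
split => //; apply: gap_compare => // z /andP[kz zk].
have oi : o (i N) <= o k by apply: order_stat_homo => //; exact: ltnW.
have oim : o k.+1 <= o (i N + m N)%N by exact: order_stat_homo.
have Ji : J (o (i N)) by apply: hJw; rewrite leqnn leq_addr.
have Jim : J (o (i N + m N)%N) by apply: hJw; rewrite leqnn leq_addr.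
have iN : (i N <= N)%N := leq_trans (leq_addr (m N) _) imN.
rewrite vstat_cellv // in l1.
rewrite vstat_cellv ?ltn_addr // in l2.
have /andP[b1 b2] := celln_bounds X (o (i N)) (ltn0Sn (N ^ 3).-1).
have /andP[b3 b4] := celln_bounds X (o (i N + m N)%N) (ltn0Sn (N ^ 3).-1).
rewrite -/(cube N) in b1 b2 b3 b4.
have L0 : 0 < (cube N)%:R :> R by rewrite ltr0n.
have LN : (cube N)%:R^-1 <= N%:R^-1 :> R.
  rewrite lef_pV2 ?posrE // cubeE // ler_nat.
  by rewrite -{1}[N]expn1 leq_pexp2l.
rewrite [_ * F _]mulrC -ler_pdivrMr // in b1.
rewrite [_ * F _]mulrC -ler_pdivrMr // in b3.
rewrite [_ * F _]mulrC -ler_pdivlMr // mulrDl mul1r in b2.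
rewrite [_ * F _]mulrC -ler_pdivlMr // mulrDl mul1r in b4.
have iN1 : N%:R^-1 <= eta / 7 :> R.
  by rewrite -[leLHS]mul1r ler_pdivrMr //; move: Neta; rewrite ler_pdivrMr //; lra.
have e1 : (i N).-1%:R / N%:R = (i N)%:R / N%:R - N%:R^-1 :> R.
  by rewrite -{2}(prednK i0) -natr1 mulrDl mul1r addrK.
have e2 : (i N + m N).-1%:R / N%:R = (i N)%:R / N%:R + (m N)%:R / N%:R - N%:R^-1 :> R.
  rewrite -mulrDl -natrD -{2}(prednK (ltn_addr (m N) i0)) -natr1 mulrDl mul1r addrK //.
have e3 : (m N)%:R / N%:R <= eta by rewrite ler_pdivrMr.
rewrite e1 in l1; rewrite e2 in l2.
move: l1 l2; rewrite !ltr_norml => /andP[l1 l1'] /andP[l2 l2'].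
have u1 : `|F (o (i N)) - (i N)%:R / N%:R| <= eta + 2 * N%:R^-1.
  rewrite ler_norml; apply/andP; split; lra.
(* On this event the first order statistic of the block is a competitor in [J], so [q N] does as
   well up to [1 / N]. *)
have u2 := qopt _ Ji.
have d1 : `|F (q N) - F (o (i N))| <= 2 * eta + 5 * N%:R^-1.
  have := ler_distD ((i N)%:R / N%:R) (F (q N)) (F (o (i N))).
  rewrite (distrC ((i N)%:R / N%:R)); lra.
have d2 : F (o (i N + m N)%N) - F (o (i N)) <= 3 * eta + 2 * N%:R^-1 by lra.
have zi : o (i N) <= z <= o (i N + m N)%N.
  by rewrite (le_trans oi (ltW kz)) (le_trans zk oim).
have hz := window_dist Ji Jim Jq zi d1 d2.
have hz6 : c * `|z - q N| <= 6 * eta by lra.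
have cq := fJ Jq.
rewrite -(ler_pM2l c0).
have : M * (c * `|z - q N|) <= M * (6 * eta) by rewrite ler_wpM2l.
have M6 : M * (6 * eta) <= t * c ^+ 2.
  by rewrite -M1E; apply: ler_wpM2r; rewrite ?lerDl // mulr_ge0 // ltW.
have tq : t * c * c <= t * c * f (q N).
  by apply: ler_wpM2l => //; rewrite mulr_ge0 // ltW.
rewrite mulrCA => h; apply: (le_trans h); apply: (le_trans M6).
by rewrite expr2 mulrA [c * _]mulrCA mulrA.
Unshelve. all: by end_near. Qed.

(** Sandwich: a spacing of at least [s] forces a cell gap at level [s - h], and a cell gap at level
    [s + h] forces a spacing above [s]. *)
Lemma good_freq (s e : R) : 0 < s -> 0 < e ->
  whp P (fun N => [set w |
    (count (fun k => s <= gap N k w) (index_iota (i N) (i N + m N)))%:R / (m N)%:R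
      <= expR (- s) + e /\
    expR (- s) - e <=
    (count (fun k => s < gap N k w) (index_iota (i N) (i N + m N)))%:R / (m N)%:R]).
Proof.
(* [h <= e / 2] because [e^(-s)] moves by at most [h] when [s] does; [h <= s / 2] keeps the level
   [s - h] positive. *)
move=> s0 e0; pose h := Num.min (e / 2) (s / 2).
have h0 : 0 < h by rewrite lt_min !divr_gt0.
have he : h <= e / 2 by rewrite ge_min lexx.
have hs : h <= s / 2 by rewrite ge_min lexx orbT.
(* Half of the margin [h] goes to the variation of the density, as [t * s = h / 2]; the other half
   covers the rounding to cells. *)
pose t := h / (2 * s).
have t0 : 0 < t by rewrite divr_gt0 // mulr_gt0.
have ts : t * s = h / 2 by rewrite /t; field; lra.
have t1 : t < 1 by rewrite ltr_pdivrMr ?mulr_gt0 // mul1r; lra.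
have s10 : 0 < s - h by lra.
have s20 : 0 < s + h by lra.
have e20 : 0 < e / 2 by lra.
have w1 := whp_spacing hindep hident hf fM s10 e20 him hm.
have w2 := whp_spacing hindep hident hf fM s20 e20 him hm.
apply: whp_sub (whpI (whp_compare t0) (whpI w1 w2)) _.
near=> N => w [cmp [/= f1 f2]].
have [i0 imN] : (0 < i N)%N /\ (i N + m N <= N)%N by near: N.
have N1 : 1 <= N%:R :> R by near: N; exact: nbhs_infty_ger.
have Nn0 : (0 < N)%N by rewrite -(ler_nat R).
have m0 : 1 <= (m N)%:R :> R by near: N; exact: hm.
have Nh : 3 / h <= N%:R by near: N; exact: nbhs_infty_ger.
have N2h : 1 < N%:R ^+ 2 * (h / 2).
  apply: (@lt_le_trans _ _ (N%:R * (h / 2))).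
    by move: Nh; rewrite ler_pdivrMr //; lra.
  by rewrite ler_wpM2r ?expr2 ?ler_peMl // ltW //; lra.
have LE : (cube N)%:R = N%:R ^+ 3 :> R by rewrite cubeE // natrX.
have cells k : (k < m N)%N ->
  (s <= gap N (i N + k) w -> cubev X N w \in
     gap_set N (cube N) (Num.truncn ((s - h) * (N ^ 2)%:R)) ((i N).-1 + k)) /\
  (cubev X N w \in
     gap_set N (cube N) (Num.truncn ((s + h) * (N ^ 2)%:R)) ((i N).-1 + k) ->
   s < gap N (i N + k) w).
  move=> km; have [] := cmp (i N + k)%N; first by rewrite leq_addr ltn_add2l.
  move=> xy hc.
  have h1 : 1 < N%:R ^+ 2 * ((1 - t) * s - (s - h)).
    have -> : (1 - t) * s - (s - h) = h / 2 by rewrite mulrBl mul1r ts; lra.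
    exact: N2h.
  have h2 : 1 <= N%:R ^+ 2 * (s + h - (1 + t) * s).
    have -> : s + h - (1 + t) * s = h / 2 by rewrite mulrDl mul1r ts; lra.
    exact: ltW.
  have := gap_cells (ltn0Sn (N ^ 3).-1) LE xy t0 t1 s10 s20 s0 h1 h2 hc.
  have ikN : (i N + k <= N)%N by rewrite (leq_trans _ imN) // leq_add2l ltnW.
  have ikN' : (i N + k < N)%N by rewrite (leq_trans _ imN) // ltn_add2l.
  have v1 : vstat (cubev X N w) ((i N).-1 + k) =
      celln X (cube N) (order_stat X N (i N + k) w).
    have -> : ((i N).-1 + k = (i N + k).-1)%N by rewrite -[in RHS](prednK i0) addSn.
    exact: vstat_cellv (ltn_addr _ i0) ikN.
  have v2 : vstat (cubev X N w) ((i N).-1 + k).+1 =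
      celln X (cube N) (order_stat X N (i N + k).+1 w).
    have -> : (((i N).-1 + k).+1 = (i N + k).+1.-1)%N by rewrite -addSn prednK.
    exact: vstat_cellv (ltn0Sn _) ikN'.
  by rewrite !inE v1 v2 /gap.
move: f1 f2; rewrite !ltr_norml => /andP[_ f1] /andP[f2 _].
have x1 := expRN_sub s (ltW s10).
have x2 := expRN_sub (s + h) (ltW s0).
rewrite [s + h - s]addrC addKr gtr0_norm // in x2.
rewrite (_ : s - (s - h) = h) ?gtr0_norm // in x1; last lra.
split; rewrite count_iota_sum.
  apply: (@le_trans _ _ (expR (- (s - h)) + e / 2)); last by lra.
  rewrite -lerBlDl; apply: le_trans (ltW f1); rewrite lerD2r.
  apply: ler_wpM2r; first by rewrite invr_ge0; lra.
  rewrite ler_nat; apply: leq_sum => k _.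
  by have [+ _] := cells k (ltn_ord k); case: (s <= _) => // ->.
apply: (@le_trans _ _ (expR (- (s + h)) - e / 2)); first by lra.
apply: (@le_trans _ _ ((\sum_(k < m N) (cubev X N w \in gap_set N (cube N)
   (Num.truncn ((s + h) * (N ^ 2)%:R)) ((i N).-1 + k)))%:R / (m N)%:R)); first by lra.
apply: ler_wpM2r; first by rewrite invr_ge0; lra.
rewrite ler_nat; apply: leq_sum => k _.
by have [_] := cells k (ltn_ord k); case: (cubev _ _ _ \in _) => // ->.
Unshelve. all: by end_near. Qed.

End good.

(** * From gaps to digits *)

(* B^(n + c) for n = j - K; thus j < 2K stands for -K <= n < K. *)
Definition digit_bound (R : realType) (B : R) (K : nat) (c : R) (j : nat) : R :=
  expR ((j%:R - K%:R + c) * ln B).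

Section digits.
Context (R : realType) (B : R) (B1 : 1 < B).
Notation x := (digit_bound B).

Lemma lnB_gt0 : 0 < ln B. Proof. exact: ln_gt0. Qed.

Lemma digit_bound_gt0 K c j : 0 < x K c j.
Proof. exact: expR_gt0. Qed.

Lemma digit_bound_le K c j t : 0 < t ->
  (x K c j <= t) = (j%:R - K%:R + c <= ln t / ln B).
Proof.
move=> t0; rewrite -{1}[t]lnK ?posrE // ler_expR ler_pdivlMr //; exact: lnB_gt0.
Qed.

Lemma digit_bound_lt K c j t : 0 < t ->
  (x K c j < t) = (j%:R - K%:R + c < ln t / ln B).
Proof.
move=> t0; rewrite -{1}[t]lnK ?posrE // ltr_expR ltr_pdivlMr //; exact: lnB_gt0.
Qed.

Context (a b : R) (a0 : 0 <= a) (ab : a <= b) (b1 : b <= 1).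

Definition indig (t : R) : bool := log_mod1 B t \in `[a, b].

Lemma floor_near (z : R) (j K : nat) :
  let w := j%:R - K%:R : R in
  [\/ w + 1 <= (Num.floor z)%:~R, (Num.floor z)%:~R + 1 <= w | (Num.floor z)%:~R = w :> R].
Proof.
move=> w; have wE : w = (j%:Z - K%:Z)%:~R by rewrite /w intrB.
have [h|h|h] := ltgtP (Num.floor z) (j%:Z - K%:Z).
- by constructor 2; rewrite wE -[1]/(1%:~R) -intrD ler_int; lia.
- by constructor 1; rewrite wE -[1]/(1%:~R) -intrD ler_int; lia.
- by constructor 3; rewrite wE h.
Qed.

(** With [n = j - K], the interval from [B^(n+a)] to [B^(n+b)] is a difference of two tails. If the
    integer part of [log_B t] exceeds [n] both tails contain [t]; if it is below [n] neither does,
    up to [t = B^(n+1)], which has integer part [n + 1]. *)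
Lemma indig_term_lower (t : R) K j : 0 < t ->
  ((x K a j <= t)%R <= (x K b j <= t)%R +
     indig t && ((Num.floor (ln t / ln B))%:~R == j%:R - K%:R :> R)%R)%N.
Proof.
move=> t0; rewrite !digit_bound_le // /indig /log_mod1 /fracpart in_itv /=.
set z := ln t / ln B; have /andP[fl1 fl2] := floor_itv z.
rewrite intrD mulr1z in fl2.
move: (floor_near z j K); move: ((Num.floor z)%:~R) fl1 fl2 => fl fl1 fl2.
clearbody z; move: a0 ab b1 => a0' ab' b1' /= -[h|h|h].
- have -> : j%:R - K%:R + b <= z by lra.
  by case: (_ <= z).
- have -> // : (j%:R - K%:R + a <= z) = false by apply/negbTE; rewrite -ltNge; lra.
- rewrite h eqxx andbT.
  have [h1|//] := boolP (j%:R - K%:R + a <= z).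
  have [//|h2] := boolP (j%:R - K%:R + b <= z).
  rewrite -ltNge in h2.
  by have -> : a <= z - (j%:R - K%:R) <= b by apply/andP; split; lra.
Qed.

(** The subtracted tail is strict here: for [b < 1] the point [B^(n+b)] belongs to the digit set and
    must not be removed. *)
Lemma indig_term_upper (t : R) K j : 0 < t ->
  (indig t && ((Num.floor (ln t / ln B))%:~R == j%:R - K%:R :> R)%R
    + (x K b j < t)%R <= (x K a j <= t)%R)%N.
Proof.
move=> t0; rewrite digit_bound_le // digit_bound_lt // /indig /log_mod1 /fracpart in_itv /=.
set z := ln t / ln B; have /andP[fl1 fl2] := floor_itv z.
rewrite intrD mulr1z in fl2.
move: (floor_near z j K); move: ((Num.floor z)%:~R) fl1 fl2 => fl fl1 fl2.
clearbody z; move: a0 ab b1 => a0' ab' b1' /= -[h|h|h].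
- have -> : j%:R - K%:R + a <= z by lra.
  have -> : (fl == j%:R - K%:R) = false by apply/eqP; lra.
  by rewrite andbF; case: (_ < z).
- have -> : (fl == j%:R - K%:R) = false by apply/eqP; lra.
  have -> : (j%:R - K%:R + b < z) = false by apply/negbTE; rewrite -leNgt; lra.
  by rewrite andbF.
- rewrite h eqxx andbT.
  have [/andP[h1 h2]|] := boolP (a <= z - (j%:R - K%:R) <= b).
    have -> : j%:R - K%:R + a <= z by lra.
    by have -> : (j%:R - K%:R + b < z) = false by apply/negbTE; rewrite -leNgt; lra.
  rewrite add0n => _; case: ltP => // h1.
  by have -> : j%:R - K%:R + a <= z by lra.
Qed.

Lemma sum_floor_le1 (z : R) K :
  (\sum_(j <- iota 0 (K + K)) ((Num.floor z)%:~R == j%:R - K%:R :> R)%R <= 1)%N.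
Proof.
have [[j jE]|h] := pselect (exists j : nat, (Num.floor z)%:~R = j%:R - K%:R :> R).
  apply: (@leq_trans (count_mem j (iota 0 (K + K)))); last first.
    by rewrite count_uniq_mem ?iota_uniq // leq_b1.
  rewrite -sum1_count [leqRHS]big_mkcond /=; apply: leq_sum => k _.
  rewrite jE (inj_eq (addIr _)) eqr_nat eq_sym; by case: (k == j).
rewrite big1 // => j _; apply/eqP; rewrite eqb0; apply/eqP => jE; apply: h.
by exists j.
Qed.

Lemma indig_lower (t : R) K :
  (\sum_(j <- iota 0 (K + K)) (x K a j <= t)%R <=
   indig t + \sum_(j <- iota 0 (K + K)) (x K b j <= t)%R)%N.
Proof.
have [t0|t0] := leP t 0.
  rewrite big1 // => j _; apply/eqP; rewrite eqb0 -ltNge.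
  exact: le_lt_trans t0 (digit_bound_gt0 _ _ _).
apply: leq_trans (leq_sum _ (fun j _ => indig_term_lower K j t0)) _.
rewrite big_split /= addnC leq_add2r.
case: (indig t); last by rewrite big1.
exact: sum_floor_le1.
Qed.

(** The two extra terms pay for [t] outside [[B^(-K), B^K[], where the integer part of [log_B t] is
    missed by the sum over [j]. *)
Lemma indig_upper (t : R) K :
  (indig t + \sum_(j <- iota 0 (K + K)) (x K b j < t)%R <=
   \sum_(j <- iota 0 (K + K)) (x K a j <= t)%R +
    ((t < x K 0 0)%R + (x K 0 (K + K) <= t)%R))%N.
Proof.
have [t0|t0] := leP t 0.
  rewrite big1 ?addn0; last first.
    move=> j _; apply/eqP; rewrite eqb0 -leNgt.
    by apply: (le_trans t0); rewrite ltW ?digit_bound_gt0.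
  (* Since [ln t = 0] for [t <= 0], such a [t] counts as a digit when [a = 0]; the lower tail term
     covers it. *)
  have -> : t < x K 0 0 by apply: (le_lt_trans t0); exact: digit_bound_gt0.
  by case: (indig t); rewrite // addnCA leq_addr.
suff ind : (indig t <= \sum_(j <- iota 0 (K + K))
    (indig t && ((Num.floor (ln t / ln B))%:~R == j%:R - K%:R :> R)%R)
    + ((t < x K 0 0)%R + (x K 0 (K + K) <= t)%R))%N.
  apply: leq_trans (leq_add ind (leqnn _)) _.
  rewrite addnAC leq_add2r -big_split /=; apply: leq_sum => j _.
  exact: indig_term_upper.
case: (indig t) => //=.
have [//|h1] := ltP t (x K 0 0); first by rewrite addnCA leq_addr.
have [//|h2] := leP (x K 0 (K + K)) t; first by rewrite addnA addn1.
move: h1 h2; rewrite digit_bound_le // => h1.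
rewrite ltNge digit_bound_le // -ltNge => h2.
rewrite add0r addr0 in h1; rewrite addr0 natrD addrK in h2.
set z := ln t / ln B in h1 h2 *.
have fK : (- K%:Z <= Num.floor z)%R by rewrite floor_ge_int intrN; exact: h1.
have fK' : (Num.floor z < K%:Z)%R by rewrite floor_lt_int; exact: h2.
pose j := `|(Num.floor z + K%:Z)%R|%N.
have jE : j%:Z = (Num.floor z + K%:Z)%R by rewrite /j gez0_abs //; lia.
have jK : j \in iota 0 (K + K) by rewrite mem_iota /=; lia.
rewrite !addn0 (big_rem j) //=.
have -> : (Num.floor z)%:~R == j%:R - K%:R :> R.
  by rewrite -[j%:R]/((j%:Z)%:~R) jE intrD addrK.
by rewrite leq_addr.
Qed.

(** The exponential mass outside [[B^(-K), B^K[]. Both parts are at most [1 / (1 + K * ln B)], by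
    repeated use of [1 + y <= e^y]. *)
Lemma tail_le K :
  1 - expR (- x K 0 0) + expR (- x K 0 (K + K)) <= 2 / (1 + K%:R * ln B).
Proof.
set u := x K 0 0; have l0 := lnB_gt0.
have KB : 0 < 1 + K%:R * ln B by rewrite ltr_pwDl // mulr_ge0 // ltW.
have hK : 1 + K%:R * ln B <= expR (K%:R * ln B) by exact: expR_ge1Dx.
have uE : u = (expR (K%:R * ln B))^-1.
  by rewrite /u /digit_bound -expRN; congr expR; lra.
have vE : x K 0 (K + K) = expR (K%:R * ln B).
  by rewrite /digit_bound natrD; congr expR; lra.
have iu : u <= (1 + K%:R * ln B)^-1 by rewrite uE lef_pV2 ?posrE ?expR_gt0.
have h1 : 1 - u <= expR (- u) by exact: expR_ge1Dx.
have h2 : expR (- x K 0 (K + K)) <= (1 + K%:R * ln B)^-1.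
  rewrite vE expRN lef_pV2 ?posrE ?expR_gt0 //; apply: (le_trans hK).
  have := expR_ge1Dx (expR (K%:R * ln B)); lra.
lra.
Qed.

(** The exponential mass of the intervals from [B^(n+a)] to [B^(n+b)] with [-K <= n < K]: the common
    value to which the empirical and the exponential digit masses are compared. *)
Definition digit_main (K : nat) : R :=
  \sum_(j <- iota 0 (K + K)) (expR (- x K a j) - expR (- x K b j)).

(* [nA], [ge c], [gt c] stand for the masses that a probability on the positive
   reals gives to the digit set, to [c, +oo[ and to ]c, +oo[. *)
Lemma digit_mass_bounds (K : nat) (e nA : R) (ge gt : R -> R) :
  (forall c j, j \in iota 0 (K + K).+1 -> c \in [:: 0; a; b] ->
     ge (x K c j) <= expR (- x K c j) + e) ->
  (forall c j, j \in iota 0 (K + K).+1 -> c \in [:: 0; a; b] ->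
     expR (- x K c j) - e <= gt (x K c j)) ->
  (forall c, gt c <= ge c) ->
  \sum_(j <- iota 0 (K + K)) ge (x K a j) <= nA + \sum_(j <- iota 0 (K + K)) ge (x K b j) ->
  nA + \sum_(j <- iota 0 (K + K)) gt (x K b j) <=
    \sum_(j <- iota 0 (K + K)) ge (x K a j) + (1 - ge (x K 0 0) + ge (x K 0 (K + K))) ->
  digit_main K - (4 * K%:R) * e <=
    nA <= digit_main K + (4 * K%:R + 2) * e + 2 / (1 + K%:R * ln B).
Proof.
move=> hge hgt hgg lo up.
have sub j : j \in iota 0 (K + K) -> j \in iota 0 (K + K).+1.
  by rewrite !mem_iota; lia.
have cst u v : \sum_(j <- iota 0 (K + K)) (u j + v) =
    \sum_(j <- iota 0 (K + K)) u j + 2 * K%:R * v :> R.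
  rewrite big_split /= big_const_seq count_predT size_iota iter_addr_0 -[v *+ _]mulr_natr natrD.
  by congr (_ + _); ring.
have SE : digit_main K = \sum_(j <- iota 0 (K + K)) expR (- x K a j)
            - \sum_(j <- iota 0 (K + K)) expR (- x K b j) by rewrite /digit_main sumrB.
(* Each sum has [2 * K] terms with error [e]; two sums enter each bound, whence [4 * K * e], and the
   two tail terms add [2 * e] to the upper one. *)
have gea : \sum_(j <- iota 0 (K + K)) ge (x K a j) <=
    \sum_(j <- iota 0 (K + K)) expR (- x K a j) + 2 * K%:R * e.
  rewrite -cst big_seq [leRHS]big_seq; apply: ler_sum => j /sub jK.
  by apply: hge => //; rewrite !inE eqxx ?orbT.
have geb : \sum_(j <- iota 0 (K + K)) ge (x K b j) <=
    \sum_(j <- iota 0 (K + K)) expR (- x K b j) + 2 * K%:R * e.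
  rewrite -cst big_seq [leRHS]big_seq; apply: ler_sum => j /sub jK.
  by apply: hge => //; rewrite !inE eqxx ?orbT.
have gta : \sum_(j <- iota 0 (K + K)) expR (- x K a j) + 2 * K%:R * (- e) <=
    \sum_(j <- iota 0 (K + K)) ge (x K a j).
  rewrite -cst big_seq [leRHS]big_seq; apply: ler_sum => j /sub jK.
  by apply: le_trans (hgg _); apply: hgt => //; rewrite !inE eqxx ?orbT.
have gtb : \sum_(j <- iota 0 (K + K)) expR (- x K b j) + 2 * K%:R * (- e) <=
    \sum_(j <- iota 0 (K + K)) gt (x K b j).
  rewrite -cst big_seq [leRHS]big_seq; apply: ler_sum => j /sub jK.
  by apply: hgt => //; rewrite !inE eqxx ?orbT.
have t0 : expR (- x K 0 0) - e <= ge (x K 0 0).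
  by apply: le_trans (hgg _); apply: hgt; rewrite ?mem_iota ?inE ?eqxx.
have t1 : ge (x K 0 (K + K)) <= expR (- x K 0 (K + K)) + e.
  by apply: hge; rewrite ?mem_iota ?inE ?eqxx //= add0n ltnSn.
have := tail_le K; rewrite /= => tl.
by rewrite SE; apply/andP; split; lra.
Qed.

End digits.

Lemma count_sum (A : Type) (p : pred A) (s : seq A) : count p s = (\sum_(k <- s) p k)%N.
Proof. by rewrite -sum1_count big_mkcond; apply: eq_bigr => k _; case: (p k). Qed.

Lemma sum_count_le (I1 I2 A : Type) (s1 : seq I1) (s2 : seq I2) (s : seq A)
    (p1 : I1 -> pred A) (p2 : I2 -> pred A) :
  (forall k, (\sum_(i <- s1) p1 i k <= \sum_(i <- s2) p2 i k)%N) ->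
  (\sum_(i <- s1) count (p1 i) s <= \sum_(i <- s2) count (p2 i) s)%N.
Proof.
move=> h; under eq_bigr do rewrite count_sum.
under [leqRHS]eq_bigr do rewrite count_sum.
rewrite exchange_big [leqRHS]exchange_big /=; apply: leq_sum => k _; exact: h.
Qed.

(** Integrates a pointwise inequality between sums of indicators, so that [indig_lower] and
    [indig_upper] serve the exponential law as well as the counts. *)
Lemma sum_measure_le (d : measure_display) (T : measurableType d) (R : realType)
    (mu : {measure set T -> \bar R}) (I1 I2 : Type) (s1 : seq I1) (s2 : seq I2)
    (F1 : I1 -> set T) (F2 : I2 -> set T) :
  (forall i, measurable (F1 i)) -> (forall i, measurable (F2 i)) ->
  (forall t, (\sum_(i <- s1) (t \in F1 i) <= \sum_(i <- s2) (t \in F2 i))%N) ->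
  (\sum_(i <- s1) mu (F1 i) <= \sum_(i <- s2) mu (F2 i))%E.
Proof.
move=> m1 m2 h.
have hI (I : Type) (s : seq I) (F : I -> set T) : (forall i, measurable (F i)) ->
    (\sum_(i <- s) mu (F i) = \int[mu]_x \sum_(i <- s) (\1_(F i) x)%:E)%E.
  move=> mF; rewrite ge0_integral_sum //.
  - by apply: eq_bigr => i _; rewrite integral_indic // setIT.
  - by move=> i; apply/measurable_EFinP; exact: measurable_indic.
rewrite (hI _ _ F1) // (hI _ _ F2) //; apply: ge0_le_integral => //.
- by move=> x _; apply: sume_ge0 => i _; rewrite lee_fin.
- by apply: emeasurable_sum => i; apply/measurable_EFinP; exact: measurable_indic.
- by apply: emeasurable_sum => i; apply/measurable_EFinP; exact: measurable_indic.
move=> x _; rewrite !sumEFin lee_fin /numfun.indic -!natr_sum ler_nat; exact: h.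
Qed.

Lemma sum_prob_le (d : measure_display) (T : measurableType d) (R : realType)
    (mu : probability T R) (I1 I2 : Type) (s1 : seq I1) (s2 : seq I2)
    (F1 : I1 -> set T) (F2 : I2 -> set T) :
  (forall i, measurable (F1 i)) -> (forall i, measurable (F2 i)) ->
  (forall t, (\sum_(i <- s1) (t \in F1 i) <= \sum_(i <- s2) (t \in F2 i))%N) ->
  \sum_(i <- s1) fine (mu (F1 i)) <= \sum_(i <- s2) fine (mu (F2 i)).
Proof.
move=> m1 m2 h; rewrite -lee_fin -!sumEFin; apply: le_trans (le_trans
  (sum_measure_le mu m1 m2 h) _).
  by apply: lee_sum => i _; rewrite fineK // fin_num_measure.
by apply: lee_sum => i _; rewrite fineK // fin_num_measure.
Qed.

Lemma exponential_probability (R : realType) :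
  exists mu : probability (measurableTypeR R) R,
    forall A, mu A = exponential_prob 1 A.
Proof. by unshelve eexists (exponential_prob 1 : probability _ _). Qed.

Section exp_mass.
Context (R : realType) (mu : probability (measurableTypeR R) R)
  (muE : forall A, mu A = exponential_prob 1 A).

Lemma exp_mass_gt c : 0 < c -> mu [set t | c < t] = (expR (- c))%:E.
Proof.
move=> c0.
have neg : mu [set t | t < 0] = 0%E.
  rewrite muE /exponential_prob; apply: integral0_eq => t /= t0.
  by rewrite lt0_exponential_pdf.
have m1 : measurable ([set t | t < 0] : set (measurableTypeR R)).
  by rewrite -set_itvNyo.
have seg : mu [set t | 0 <= t <= c] = (1 - expR (- c))%:E.
  have -> : [set t | 0 <= t <= c] = `[0, c]%classic by rewrite set_itvcc.
  by rewrite muE exponential_prob_itv0c // mulN1r.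
have m2 : measurable ([set t | 0 <= t <= c] : set (measurableTypeR R)).
  by rewrite -set_itvcc.
have -> : [set t | c < t] = ~` ([set t | t < 0] `|` [set t | 0 <= t <= c]).
  apply/seteqP; split => t /=.
    by move=> ct [|/andP[_]]; lra.
  move=> h; rewrite ltNge; apply/negP => tc; apply: h.
  by have [?|?] := ltP t 0; [left|right; apply/andP].
rewrite probability_setC; last exact: measurableU.
have -> : (expR (- c))%:E = (1 - (1 - expR (- c))%:E)%E.
  by rewrite -EFinB; congr EFin; lra.
congr (_ - _)%E; rewrite -seg -[RHS]add0e -neg; apply: measureU => //.
by apply/seteqP; split => t //= [t0 /andP[]]; lra.
Qed.

Lemma exp_mass_ge c : 0 < c -> mu [set t | c <= t] = (expR (- c))%:E.
Proof.
move=> c0; have -> : [set t | c <= t] = [set c] `|` [set t | c < t].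
  apply/seteqP; split => t /=.
    by rewrite le_eqVlt => /predU1P[->|]; [left|right].
  by move=> [->|/ltW].
have m2 : measurable ([set t | c < t] : set (measurableTypeR R)).
  by rewrite -set_itvoy.
have c1 : mu [set c] = 0%E by rewrite muE /exponential_prob integral_set1.
rewrite -exp_mass_gt // -[RHS]add0e -c1; apply: measureU => //.
by apply/seteqP; split => t //= [->]; rewrite ltxx.
Qed.

End exp_mass.

Lemma measurable_indig (R : realType) (B a b : R) :
  measurable [set t : R | log_mod1 B t \in `[a, b]].
Proof.
have mf : measurable_fun [set: R] (log_mod1 B).
  rewrite /log_mod1 /fracpart; apply: measurable_funB.
    by apply: measurable_funM => //; exact: measurable_ln.
  apply: (measurableT_comp (f := fun z : R => (Num.floor z)%:~R : R)).
    apply: nondecreasing_measurable => // x y xy.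
    by rewrite ler_int le_floor.
  by apply: measurable_funM => //; exact: measurable_ln.
rewrite -[X in measurable X]setTI.
exact: (mf measurableT `[a, b]%classic (measurable_itv _)).
Qed.

(** The case [e = 0] of [digit_mass_bounds], since the tails of the exponential law are exact. *)
Lemma exp_digit_mass (R : realType) (B a b : R) (K : nat) : 1 < B ->
  0 <= a -> a <= b -> b <= 1 ->
  digit_main B a b K <= exponential_digit_prob B a b
    <= digit_main B a b K + 2 / (1 + K%:R * ln B).
Proof.
move=> B1 a0 ab b1; have [mu muE] := exponential_probability R.
rewrite /exponential_digit_prob -muE; set A := [set t | _].
have mA : measurable (A : set (measurableTypeR R)) by exact: measurable_indig.
have mge c : measurable ([set t | c <= t] : set (measurableTypeR R)).
  by rewrite -set_itvcy.
have mgt c : measurable ([set t | c < t] : set (measurableTypeR R)).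
  by rewrite -set_itvoy.
pose ge c := fine (mu [set t | c <= t]); pose gt c := fine (mu [set t | c < t]).
have geE c : 0 < c -> ge c = expR (- c) by move=> c0; rewrite /ge exp_mass_ge.
have gtE c : 0 < c -> gt c = expR (- c) by move=> c0; rewrite /gt exp_mass_gt.
have inA (p : pred R) (t : R) : (t \in [set t | p t]) = p t by exact: asboolb.
have := @digit_mass_bounds R B B1 a b a0 ab b1 K 0 (fine (mu A)) ge gt.
rewrite !mulr0 subr0 addr0; apply.
- by move=> c j _ _; rewrite geE ?addr0 // digit_bound_gt0.
- by move=> c j _ _; rewrite gtE ?subr0 // digit_bound_gt0.
- move=> c; rewrite /gt /ge fine_le ?fin_num_measure // le_measure ?inE //.
  by move=> t /ltW.
(* Only the family of sets is indexed: [None] carries the digit set and [Some j] the tails at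
   [B^(n+b)]. *)
- have := @sum_prob_le _ _ _ mu nat (option nat) (iota 0 (K + K))
    (None :: map Some (iota 0 (K + K)))
    (fun j => [set t | digit_bound B K a j <= t])
    (fun o => if o is Some j then [set t | digit_bound B K b j <= t] else A).
  rewrite big_cons big_map; apply => //.
    by move=> [j|].
  move=> t; rewrite big_cons big_map inA.
  under eq_bigr do rewrite inA.
  under [X in (_ <= _ + X)%N]eq_bigr do rewrite inA.
  exact: indig_lower.
have x00 : 0 < digit_bound B K 0 0 by exact: digit_bound_gt0.
have lt0 : fine (mu [set t | t < digit_bound B K 0 0]) = 1 - ge (digit_bound B K 0 0).
  have -> : [set t | t < digit_bound B K 0 0] = ~` [set t | digit_bound B K 0 0 <= t].
    by apply/seteqP; split => t /= => [|/negP]; rewrite ltNge; [move/negP|].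
  by rewrite probability_setC // fineB // fin_num_measure.
have mlt c : measurable ([set t | t < c] : set (measurableTypeR R)).
  by rewrite -set_itvNyo.
have := @sum_prob_le _ _ _ mu (option nat) (nat + bool)
  (None :: map Some (iota 0 (K + K)))
  (inr true :: inr false :: map inl (iota 0 (K + K)))
  (fun o => if o is Some j then [set t | digit_bound B K b j < t] else A)
  (fun o => match o with inl j => [set t | digit_bound B K a j <= t]
     | inr true => [set t | t < digit_bound B K 0 0]
     | inr false => [set t | digit_bound B K 0 (K + K) <= t] end).
rewrite !big_cons !big_map lt0 /= => h; rewrite [leRHS]addrC -addrA; apply: h.
- by move=> [j|].
- by move=> [j|[]].
move=> t; rewrite !big_cons !big_map !inA.
under eq_bigr do rewrite inA.
under [X in (_ <= _ + (_ + X))%N]eq_bigr do rewrite inA.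
apply: leq_trans (indig_upper _ _ _ _ _ _) _ => //.
by rewrite [leqRHS]addnA [leqRHS]addnC.
Qed.

Lemma count_digit_mass (R : realType) (B a b e : R) (K : nat) (D : nat -> R)
    (s : seq nat) : 1 < B -> 0 <= a -> a <= b -> b <= 1 -> (0 < size s)%N ->
  (forall c j, j \in iota 0 (K + K).+1 -> c \in [:: 0; a; b] ->
     (count (fun k => digit_bound B K c j <= D k) s)%:R / (size s)%:R
       <= expR (- digit_bound B K c j) + e) ->
  (forall c j, j \in iota 0 (K + K).+1 -> c \in [:: 0; a; b] ->
     expR (- digit_bound B K c j) - e <=
     (count (fun k => digit_bound B K c j < D k) s)%:R / (size s)%:R) ->
  digit_main B a b K - 4 * K%:R * e <=
    (count (fun k => log_mod1 B (D k) \in `[a, b]) s)%:R / (size s)%:R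
    <= digit_main B a b K + (4 * K%:R + 2) * e + 2 / (1 + K%:R * ln B).
Proof.
move=> B1 a0 ab b1 s0 hge hgt; have sR : 0 < (size s)%:R :> R by rewrite ltr0n.
pose ge c := (count (fun k => c <= D k) s)%:R / (size s)%:R : R.
pose gt c := (count (fun k => c < D k) s)%:R / (size s)%:R : R.
apply: (@digit_mass_bounds R B B1 a b a0 ab b1 K e _ ge gt) => //.
- move=> c; rewrite ler_pM2r ?invr_gt0 // ler_nat; apply: sub_count => k; exact: ltW.
- rewrite /ge -!mulr_suml -mulrDl ler_pM2r ?invr_gt0 // -!natr_sum -natrD ler_nat.
  have := @sum_count_le nat (option nat) nat (iota 0 (K + K))
    (None :: map Some (iota 0 (K + K))) s (fun j k => digit_bound B K a j <= D k)
    (fun o k => if o is Some j then digit_bound B K b j <= D k else indig B a b (D k)).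
  rewrite big_cons big_map; apply=> k; rewrite big_cons big_map.
  exact: indig_lower.
have cC : 1 - ge (digit_bound B K 0 0) =
    (count (fun k => D k < digit_bound B K 0 0) s)%:R / (size s)%:R.
  rewrite /ge -[X in X - _](divff (lt0r_neq0 sR)) -mulrBl; congr (_ / _).
  rewrite -[X in X%:R - _](count_predC (fun k => digit_bound B K 0 0 <= D k) s).
  rewrite natrD [X in X - _]addrC addrK.
  by congr _%:R; apply: eq_count => k /=; rewrite ltNge.
rewrite cC /ge /gt -!mulr_suml -!mulrDl ler_pM2r ?invr_gt0 // -!natr_sum -!natrD ler_nat.
have := @sum_count_le (option nat) (nat + bool) nat (None :: map Some (iota 0 (K + K)))
  (inr true :: inr false :: map inl (iota 0 (K + K))) s
  (fun o k => if o is Some j then digit_bound B K b j < D k else indig B a b (D k))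
  (fun o k => match o with inl j => digit_bound B K a j <= D k
     | inr true => D k < digit_bound B K 0 0
     | inr false => digit_bound B K 0 (K + K) <= D k end).
rewrite !big_cons !big_map => h; rewrite [leqRHS]addnC -addnA; apply: h => k.
rewrite !big_cons !big_map [leqRHS]addnA [leqRHS]addnC.
exact: indig_upper.
Qed.

(** * Measurability, and growth of the block size *)

Lemma measurable_count (d : measure_display) (T : measurableType d) (R : realType)
    (s : seq nat) (p : nat -> T -> bool) :
  (forall j, measurable [set w | p j w]) ->
  measurable_fun [set: T] (fun w => (count (p ^~ w) s)%:R : R).
Proof.
move=> mp.
have -> : (fun w => (count (p ^~ w) s)%:R : R) =
    (fun w => \sum_(j <- s) \1_[set w | p j w] w).
  apply/funext => w; rewrite count_sum natr_sum; apply: eq_bigr => j _.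
  by rewrite /numfun.indic; congr (nat_of_bool _)%:R; apply/esym; exact: asboolb.
by apply: measurable_sum => j; exact: measurable_indic.
Qed.

Lemma measurable_order_stat (d : measure_display) (T : measurableType d)
    (R : realType) (P : probability T R) (X : nat -> {RV P >-> R}) N k :
  measurable_fun [set: T] (order_stat X N k).
Proof.
have [kN|Nk] := ltnP k.-1 N; last first.
  have -> : order_stat X N k = cst 0.
    by apply/funext => w; rewrite /order_stat nth_default // size_sort size_mkseq.
  exact: measurable_cst.
apply: (measurability _ (RGenCInfty.measurableE R)).
move=> _ [_ [x ->] <-]; rewrite setTI.
pose c w : R := (count (fun j => X j w < x) (iota 0 N))%:R.
(* The event that an order statistic is at least [x] says that at most [k - 1] of the variables are
   below [x]. *)
have -> : order_stat X N k @^-1` `[x, +oo[ = c @^-1` `]-oo, k.-1%:R].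
  apply/seteqP; split => w /=; rewrite !in_itv /= ?andbT /c ler_nat /order_stat
    nth_sort_count ?size_mkseq // count_map //.
have mc : measurable_fun [set: T] c.
  apply: measurable_count => j.
  have -> : [set w | X j w < x] = X j @^-1` `]-oo, x[.
    by apply/seteqP; split => w /=; rewrite in_itv.
  exact: measurable_funPTI.
rewrite -[X in measurable X]setTI; exact: mc.
Qed.

Lemma powR_nat_ge (R : realType) (p A : R) : 0 < p ->
  \forall N \near \oo, A <= N%:R `^ p.
Proof.
move=> p0; pose y := Num.max A 1; near=> N.
have y1 : 1 <= y by rewrite le_max lexx orbT.
have Ny : y `^ p^-1 <= N%:R by near: N; exact: nbhs_infty_ger.
apply: (@le_trans _ _ y); first by rewrite le_max lexx.
have -> : y = (y `^ p^-1) `^ p.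
  by rewrite -powRrM mulVf ?lt0r_neq0 // powRr1 // (le_trans _ y1).
by apply: ge0_ler_powR; rewrite ?nnegrE ?powR_ge0 // ltW.
Unshelve. all: by end_near. Qed.

(** Makes the Chebyshev term [1 / m] vanish. *)
Lemma block_size_ge (R : realType) (delta A : R) : 0 < delta ->
  \forall N \near \oo, A <= (block_size delta N)%:R.
Proof.
move=> d0; near=> N.
have h : A + 1 <= N%:R `^ delta by near: N; exact: powR_nat_ge.
have /andP[_] := truncn_itv (powR_ge0 (N%:R : R) delta).
rewrite -/(block_size delta N) -natr1; lra.
Unshelve. all: by end_near. Qed.

(** Makes the block a vanishing fraction of the sample, so that one value [f (q N)] serves all of
    it. *)
Lemma block_size_le (R : realType) (delta e : R) : delta < 1 -> 0 < e ->
  \forall N \near \oo, (block_size delta N)%:R <= e * N%:R.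
Proof.
move=> d1 e0; near=> N.
have N1 : 1 <= N%:R :> R by near: N; exact: nbhs_infty_ger.
have N0 : 0 < N%:R :> R by exact: lt_le_trans N1.
have h : e^-1 <= N%:R `^ (1 - delta).
  by near: N; apply: powR_nat_ge; rewrite subr_gt0.
have /andP[+ _] := truncn_itv (powR_ge0 (N%:R : R) delta).
move=> /le_trans; apply.
have NE : N%:R `^ delta * N%:R `^ (1 - delta) = N%:R :> R.
  by rewrite -powRD ?lt0r_neq0 ?implybT // addrC subrK powRr1 // ltW.
rewrite -[X in _ <= e * X]NE mulrCA ler_peMr ?powR_ge0 //.
by rewrite -ler_pdivrMl // mulr1.
Unshelve. all: by end_near. Qed.

(** If [A] failed, [E N] would be empty and the whole space would have mass at most [1 / 2]. It
    yields a point of [J]. *)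
Lemma whp_nonempty (d : measure_display) (T : measurableType d) (R : realType)
    (P : probability T R) (E : nat -> set T) (A : Prop) :
  whp P E -> (\forall N \near \oo, forall w, E N w -> A) -> A.
Proof.
move=> hE hA; have [//|nA] := pselect A.
have h2 : 0 < (2^-1 : R) by rewrite invr_gt0.
suff /filter_ex[_ []] : \forall N \near \oo, False by [].
apply: filterS2 (hE _ h2) hA => N [M [mM EM PM]] hN.
have MT : M = setT.
  by apply/seteqP; split => // w _; apply: EM => /hN.
by move: PM; rewrite MT probability_setT lee_fin; lra.
Qed.

Lemma measurable_digit_freq (d : measure_display) (T : measurableType d)
    (R : realType) (P : probability T R) (X : nat -> {RV P >-> R}) B c a b N i m :
  measurable_fun [set: T] (digit_freq X B c a b N i m).
Proof.
apply: measurable_funM => //.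
apply: (@measurable_count d T R _ (fun k w => log_mod1 B
   (c * (order_stat X N k.+1 w - order_stat X N k w)) \in `[a, b])) => k.
pose g w := c * (order_stat X N k.+1 w - order_stat X N k w).
have mg : measurable_fun [set: T] g.
  apply: measurable_funM => //; apply: measurable_funB; exact: measurable_order_stat.
rewrite -[X in measurable X]setTI.
exact: (mg measurableT _ (measurable_indig B a b)).
Qed.

Theorem theorem1p4 (R : realType) (B delta : R) (hB : 1 < B)
    (hdelta0 : 0 < delta) (hdelta1 : delta < 1)
    (d : measure_display) (T : measurableType d) (P : probability T R)
    (X : nat -> {RV P >-> R}) (f : R -> R)
    (hindep : independent_RVs X) (hident : identically_distributed X)
    (hdens : forall j, has_density (X j) f)
    (hf : twice_derivable_bounded f)
    (J : set R) (hJ : is_interval J) (hfJ : bounded_away_from_zero f J)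
    (i : nat -> nat)
    (hi : forall N : nat, (2 <= N)%N ->
       (1 <= i N)%N /\ (i N + block_size delta N <= N)%N)
    (hiJ : P [set w | forall k : nat,
                (i N <= k <= i N + block_size delta N)%N ->
                J (order_stat X N k w)] @[N --> \oo] --> 1%E) :
  exists C : nat -> R, (forall N, 0 < C N) /\
    forall a b : R, 0 <= a -> a <= b -> b <= 1 ->
      cvg_in_probability P
        (fun N => digit_freq X B (C N) a b N (i N) (block_size delta N))
        (exponential_digit_prob B a b).
Proof.
case: hfJ => c c0 fJ; case: hf => df _ [M fM].
have flip := lipschitz_of_deriv df (fun x => (fM x).1).
set m := block_size delta.
have him : \forall N \near \oo, (0 < i N)%N /\ (i N + m N <= N)%N.
  by near=> N; apply: hi; near: N; exact: nbhs_infty_ge.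
have wJ : whp P (fun N => [set w | forall k : nat, (i N <= k <= i N + m N)%N ->
    J (order_stat X N k w)]).
  apply: whp_cvg1 hiJ => N.
  have -> : [set w | forall k : nat, (i N <= k <= i N + m N)%N ->
      J (order_stat X N k w)] =
    \bigcap_(k in [set k | (i N <= k <= i N + m N)%N]) (order_stat X N k @^-1` J).
    by apply/seteqP; split.
  apply: fin_bigcap_measurable => [|k _].
    by apply: sub_finite_set (finite_II (i N + m N).+1) => k /= /andP[_].
  rewrite -[X in measurable X]setTI.
  have mo : measurable_fun [set: T] (order_stat X N k) by exact: measurable_order_stat.
  exact: (mo measurableT J (is_interval_measurable hJ)).
have J0 : J !=set0.
  apply: (whp_nonempty wJ); near=> N => w /(_ (i N)).
  by rewrite leqnn leq_addr => /(_ isT); exists (order_stat X N (i N) w).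
(* The tolerance is [1 / N] for positive [N]; [N.-1.+1] keeps it positive at [N = 0], so that [q] is
   chosen for every [N]. *)
have /choice[q hq] : forall N : nat, exists x, J x /\ forall y, J y ->
    `|rcdf (X 0) x - (i N)%:R / N%:R| <= `|rcdf (X 0) y - (i N)%:R / N%:R| + N.-1.+1%:R^-1.
  by move=> N; apply: near_minimizer => //; rewrite invr_gt0 ltr0n.
have hq' : \forall N \near \oo, J (q N) /\ forall y, J y ->
    `|rcdf (X 0) (q N) - (i N)%:R / N%:R| <= `|rcdf (X 0) y - (i N)%:R / N%:R| + N%:R^-1.
  near=> N; have N0 : (0 < N)%N by near: N; exact: nbhs_infty_gt.
  by have := hq N; rewrite prednK.
(* N.-1.+1 instead of N keeps C_0 positive. *)
exists (fun N => N.-1.+1%:R * f (q N)); split.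
  by move=> N; rewrite mulr_gt0 ?ltr0n // (lt_le_trans c0) // fJ //; case: (hq N).
move=> a b a0 ab b1 eps eps0.
pose Y N := digit_freq X B (N.-1.+1%:R * f (q N)) a b N (i N) (m N).
apply: (whp_cvg0 (E := fun N => [set w | eps <= `|Y N w - exponential_digit_prob B a b|])).
  move=> N; pose g w := `|Y N w - exponential_digit_prob B a b|.
  have mg : measurable_fun [set: T] g.
    apply: measurableT_comp => //; apply: measurable_funB => //.
    exact: measurable_digit_freq.
  have -> : [set w | eps <= `|Y N w - exponential_digit_prob B a b|]
      = g @^-1` `[eps, +oo[.
    by apply/seteqP; split => w /=; rewrite in_itv /= andbT.
  rewrite -[X in measurable X]setTI.
  exact: (mg measurableT `[eps, +oo[%classic (measurable_itv _)).
have lB : 0 < ln B by exact: ln_gt0.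
(* Truncating to [2 * K] intervals costs [eps / 4], and by the choice of [e] below the frequency
   errors cost another [eps / 4]; the total stays below [eps]. *)
pose K := (Num.truncn (8 / eps / ln B)).+1.
have hK : 2 / (1 + K%:R * ln B) <= eps / 4.
  have hK8 : 8 / eps <= K%:R * ln B by rewrite -ler_pdivrMr // ltW // truncnS_gt.
  have K0 : 0 < 8 / eps by rewrite divr_gt0.
  rewrite ler_pdivrMr; last by lra.
  have := ler_wpM2l (ltW eps0) hK8; rewrite mulrCA divff ?lt0r_neq0 //; lra.
pose e := eps / (4 * (4 * K%:R + 2)).
have K42 : 0 < 4 * (4 * K%:R + 2) :> R by rewrite mulr_gt0 // addr_gt0 ?mulr_gt0 // ltr0n.
have e0 : 0 < e by rewrite divr_gt0.
have eE : (4 * K%:R + 2) * e = eps / 4.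
  by rewrite /e; field; rewrite lt0r_neq0 // addr_gt0 ?mulr_gt0 // ltr0n.
(* Finitely many thresholds, fixed before [N], at which [good_freq] is invoked; the offset 0
   supplies [B^(-K)] and [B^K] for the tails. *)
pose Z := [seq digit_bound B K c' j | c' <- [:: 0; a; b], j <- iota 0 (K + K).+1].
have Z0 z : z \in Z -> 0 < z.
  by move=> /allpairsP[[c' j] [_ _ ->]]; exact: digit_bound_gt0.
have wZ := whp_all (s := Z) (fun z (zZ : z \in Z) => good_freq hindep hident (hdens 0)
  flip hJ c0 fJ him (fun A => block_size_ge A hdelta0)
  (fun e => block_size_le hdelta1) hq' wJ (Z0 z zZ) e0).
apply: whp_sub wZ _.
near=> N => w hw /=; apply/negP; rewrite -ltNge.
have N0 : (0 < N)%N by near: N; exact: nbhs_infty_gt.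
have m1 : 1 <= (m N)%:R :> R by near: N; exact: block_size_ge.
have m0 : (0 < m N)%N by rewrite -(ler1n R).
have sz : size (index_iota (i N) (i N + m N)) = m N.
  by rewrite size_iota addnC addnK.
have := @count_digit_mass R B a b e K (fun k => gap X f q N k w)
  (index_iota (i N) (i N + m N)) hB a0 ab b1.
rewrite sz => /(_ m0).
have hZ c' j : j \in iota 0 (K + K).+1 -> c' \in [:: 0; a; b] -> digit_bound B K c' j \in Z.
  by move=> jK cK; apply/allpairsP; exists (c', j).
move=> /(_ (fun c' j jK cK => (hw _ (hZ c' j jK cK)).1)).
move=> /(_ (fun c' j jK cK => (hw _ (hZ c' j jK cK)).2)) /andP[h1 h2].
have /andP[h3 h4] := exp_digit_mass K hB a0 ab b1.
have -> : Y N w = (count (fun k => log_mod1 B (gap X f q N k w) \in `[a, b])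
   (index_iota (i N) (i N + m N)))%:R / (m N)%:R.
  by rewrite /Y /digit_freq prednK.
have e2 : 0 <= 2 * e by rewrite mulr_ge0 // ltW.
rewrite ltr_norml; apply/andP; split; lra.
Unshelve. all: by end_near. Qed.
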